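(* Let $T=\{3,6\}/\Gamma$ be a polyhedral equivelar triangulated torus with $n$ vertices, let $L\subset\mathbb Z^{3n}$ be the sublattice spanned by the vectors $f_{k,p}$ of the context, let $B$ be the $3n\times3n$ matrix with columns the $f_{k,p}$, and let $d=\gcd\left(\frac n{|\tau_i|},\frac n{|\tau_j|}\right)$ for $i\ne j$. Then there is an isomorphism $\operatorname{Coker}B\simeq F\oplus\mathbb Z_d$, where $F$ is free of rank $n+2$. In particular $$\mathrm{Sat}\,L/L\simeq\mathbb Z_d .$$
   Context: Let $\mathbb T\subset\mathbb R^2$ be the lattice generated by $\tau_1=(1,0)$, $\tau_2=\frac12(-1,\sqrt3)$, $\tau_3=\frac12(-1,-\sqrt3)$ (so $\tau_1+\tau_2+\tau_3=0$). $\{3,6\}$ is the tessellation of $\mathbb R^2$ by equilateral triangles with vertex set $\mathbb T$ and edges $\{p,p+\tau_k\}$. Let $\Gamma\subseteq\mathbb T$ be a sublattice of index $n$, $T=\{3,6\}/\Gamma$, $G=\mathbb T/\Gamma$. $T$ is assumed polyhedral: the intersection of two triangles is a common face (empty, a vertex or an edge). $G$ acts simply transitively on $\mathrm{vert}\,T$ by translations; $\pm\tau_k(p)$ means $p\pm\tau_k$; $|\tau_k|$ is the order of $\tau_k$ in $G$. The number $d$ does not depend on the choice of $i\neq j$. Let $\varepsilon_{p,q}=\varepsilon_{q,p}$ be the standard basis of $\mathbb Z^{3n}$ indexed by the $3n$ edges $\{p,\tau_k(p)\}$ of $T$. For $p\in\mathrm{vert}\,T$: $$f_{3,p}=\varepsilon_{p,\tau_1(p)}+\varepsilon_{p,-\tau_2(p)}-\varepsilon_{p,\tau_2(p)}-\varepsilon_{p,-\tau_1(p)},$$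 $$f_{2,p}=\varepsilon_{p,\tau_3(p)}+\varepsilon_{p,-\tau_1(p)}-\varepsilon_{p,\tau_1(p)}-\varepsilon_{p,-\tau_3(p)},$$ $$f_{1,p}=\varepsilon_{p,\tau_2(p)}+\varepsilon_{p,-\tau_3(p)}-\varepsilon_{p,\tau_3(p)}-\varepsilon_{p,-\tau_2(p)}.$$ $\mathrm{Sat}\,L=\{v\in\mathbb Z^{3n}:mv\in L\text{ for some integer }m\ne0\}$, and $\mathbb Z_d=\mathbb Z/d\mathbb Z$. *)

(* Defs.v *)
From HB Require Import structures.
From mathcomp Require Import all_boot all_order all_algebra.
From mathcomp Require Import fingroup finalg generic_quotient ring_quotient.
From mathcomp Require Import boolp classical_sets functions cardinality reals.

Set Implicit Arguments.
Unset Strict Implicit.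
Unset Printing Implicit Defensive.

Import Order.TTheory GRing.Theory Num.Theory.

Local Open Scope ring_scope.
Local Open Scope quotient_scope.

Definition zmod_iso (U V : zmodType) : Prop :=
  exists f : {additive U -> V}, bijective f.

(* {ideal_quot N} only uses that N is an additive subgroup. *)

(* The image of S in V / N; when N is contained in S this is S / N, realised
   as a subgroup of V / N. *)
Definition subquot_pred (V : zmodType) (S N : zmodClosed V) :
    {pred {ideal_quot N}} :=
  fun x => `[< exists2 s, s \in S & x = \pi_{ideal_quot N} s >].

Arguments subquot_pred {V} S N.

Lemma subquot_pred_closed V S N : zmod_closed (@subquot_pred V S N).
Proof.
split=> [|x y /asboolP[s sS ->] /asboolP[t tS ->]].
  by apply/asboolP; exists 0; rewrite ?rpred0 ?raddf0.
by apply/asboolP; exists (s - t); rewrite ?rpredB ?raddfB.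
Qed.

HB.instance Definition _ (V : zmodType) (S N : zmodClosed V) :=
  GRing.isZmodClosed.Build _ (subquot_pred S N) (@subquot_pred_closed V S N).

Record subquot (V : zmodType) (S N : zmodClosed V) := SubQuot {
  subquot_val :> {ideal_quot N};
  subquot_valP : subquot_val \in subquot_pred S N }.

Section SubquotInstances.
Variables (V : zmodType) (S N : zmodClosed V).
HB.instance Definition _ := [isSub for @subquot_val V S N].
HB.instance Definition _ := [Choice of subquot S N by <:].
HB.instance Definition _ := [SubChoice_isSubZmodule of subquot S N by <:].
End SubquotInstances.

Lemma subquot_piP (V : zmodType) (S N : zmodClosed V) (s : V) :
  s \in S -> \pi_{ideal_quot N} s \in subquot_pred S N.
Proof. by move=> sS; apply/asboolP; exists s. Qed.

Definition subquot_pi (V : zmodType) (S N : zmodClosed V) (s : V)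
    (sS : s \in S) : subquot S N :=
  SubQuot (subquot_piP N sS).

(* The cyclic group Z / dZ, for every d (trivial when d = 1). *)
Definition Zmod (d : nat) : zmodType := {ideal_quot (GRing.ZmodClosed.clone int (dvdz d) _)}.

Definition int_span_pred (V : zmodType) (I : finType) (f : I -> V) : {pred V} :=
  fun v => `[< exists c : I -> int, v = \sum_i f i *~ c i >].

Lemma int_span_pred_closed V I f : zmod_closed (@int_span_pred V I f).
Proof.
split=> [|x y /asboolP[c ->] /asboolP[e ->]]; apply/asboolP.
  by exists (fun=> 0); rewrite big1.
exists (fun i => c i - e i); rewrite -sumrB.
by apply: eq_bigr => i _; rewrite mulrzBr.
Qed.

HB.instance Definition _ (V : zmodType) (I : finType) (f : I -> V) :=
  GRing.isZmodClosed.Build V (int_span_pred f)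
    (@int_span_pred_closed V I f).

Definition int_span (V : zmodType) (I : finType) (f : I -> V) : zmodClosed V :=
  GRing.ZmodClosed.clone V (int_span_pred f) _.

Definition Sat_pred (V : zmodType) (L : zmodClosed V) : {pred V} :=
  fun v => `[< exists2 m : int, m != 0 & v *~ m \in L >].

Lemma Sat_pred_closed V L : zmod_closed (@Sat_pred V L).
Proof.
split=> [|x y /asboolP[m m0 xL] /asboolP[p p0 yL]]; apply/asboolP.
  by exists 1; rewrite // mul0rz rpred0.
exists (m * p); first by rewrite mulf_neq0.
rewrite mulrzBl rpredB //; first by rewrite mulrzA rpredMz.
by rewrite mulrC mulrzA rpredMz.
Qed.

HB.instance Definition _ (V : zmodType) (L : zmodClosed V) :=
  GRing.isZmodClosed.Build V (Sat_pred L) (@Sat_pred_closed V L).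

Definition Sat (V : zmodType) (L : zmodClosed V) : zmodClosed V :=
  GRing.ZmodClosed.clone V (Sat_pred L) _.

Definition im_mx_pred (m n : nat) (B : 'M[int]_(m, n)) : {pred 'cV[int]_m} :=
  fun v => `[< exists x : 'cV[int]_n, v = B *m x >].

Lemma im_mx_pred_closed m n B : zmod_closed (@im_mx_pred m n B).
Proof.
split=> [|x y /asboolP[u ->] /asboolP[v ->]]; apply/asboolP.
  by exists 0; rewrite mulmx0.
by exists (u - v); rewrite mulmxBr.
Qed.

HB.instance Definition _ (m n : nat) (B : 'M[int]_(m, n)) :=
  GRing.isZmodClosed.Build _ (im_mx_pred B) (@im_mx_pred_closed m n B).

Definition im_mx (m n : nat) (B : 'M[int]_(m, n)) : zmodClosed 'cV[int]_m :=
  GRing.ZmodClosed.clone 'cV[int]_m (im_mx_pred B) _.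

Definition Coker (m n : nat) (B : 'M[int]_(m, n)) : zmodType :=
  {ideal_quot (im_mx B)}.

Section Plane.
Variable R : realType.

Notation plane := 'rV[R]_2.

Definition pt (x y : R) : plane := \row_j (if j == 0 then x else y).

(* Indices are shifted: tau 0, tau 1, tau 2 are tau_1, tau_2, tau_3. *)
Definition tau (k : 'I_3) : plane :=
  match val k with
  | 0%N => pt 1 0
  | 1%N => pt (- 1 / 2) (Num.sqrt 3 / 2)
  | _ => pt (- 1 / 2) (- Num.sqrt 3 / 2)
  end.

Definition lattice : zmodClosed plane := int_span tau.

Lemma tau_lattice k : tau k \in lattice.
Proof.
apply/asboolP; exists (fun i => (i == k)%:Z).
rewrite (bigD1 k) //= eqxx big1 ?addr0 // => i /negPf ->.
by [].
Qed.

Definition adjacent (p q : plane) : Prop :=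
  exists k, q = p + tau k \/ p = q + tau k.

Local Open Scope classical_set_scope.

Definition hull3 (a b c : plane) : set plane :=
  [set x | exists u v w : R, [/\ 0 <= u, 0 <= v, 0 <= w, u + v + w = 1
                               & x = u *: a + v *: b + w *: c]].

Section Torus.
Variable Gamma : zmodClosed plane.

(* The underlying surface of {3,6} / Gamma is the quotient of the plane by
   Gamma; cells are its closed subsets obtained by projecting cells of {3,6}. *)
Notation torus := {ideal_quot Gamma}.

Definition is_vertex (F : set torus) : Prop :=
  exists2 a, a \in lattice & F = \pi_torus @` [set a].

Definition is_edge (F : set torus) : Prop :=
  exists a b, [/\ a \in lattice, b \in lattice, adjacent a b
                & F = \pi_torus @` hull3 a b b].

Definition is_triangle (F : set torus) : Prop :=
  exists a b c,
    [/\ [/\ a \in lattice, b \in lattice & c \in lattice],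
        [/\ adjacent a b, adjacent b c & adjacent a c]
      & F = \pi_torus @` hull3 a b c].

(* A vertex or edge equal to D1 `&` D2 lies in both triangles, hence is a face
   of both. *)
Definition polyhedral : Prop :=
  forall D1 D2, is_triangle D1 -> is_triangle D2 -> D1 <> D2 ->
    [\/ D1 `&` D2 = set0, is_vertex (D1 `&` D2) | is_edge (D1 `&` D2)].

Definition sublattice_of_index (n : nat) : Prop :=
  {subset Gamma <= lattice} /\
  ([set: subquot lattice Gamma] #= `I_n)%card.

Variable n : nat.

(* The group T / Gamma, also the vertex set of the torus, on which it acts by
   translations. The proof argument makes it a finite type. *)
Definition vert (_ : sublattice_of_index n) := subquot lattice Gamma.

Variable hG : sublattice_of_index n.

HB.instance Definition _ := GRing.Zmodule.on (vert hG).

Lemma vert_ord : exists f : vert hG -> 'I_n, injective f.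
Proof.
have /card_set_bijP[f [fI f_inj _]] := hG.2.
have fn x : (f x < n)%N by exact: (fI x I).
exists (fun x => Ordinal (fn x)) => x y [fxy].
by apply: f_inj; rewrite ?inE.
Qed.

Definition vert_rank : vert hG -> 'I_n := sval (cid vert_ord).

Definition vert_unrank (i : 'I_n) : option (vert hG) :=
  if pselect (exists x, vert_rank x = i) is left e then Some (sval (cid e))
  else None.

Lemma vert_rankK : pcancel vert_rank vert_unrank.
Proof.
move=> x; rewrite /vert_unrank; case: pselect => [e|[]]; last by exists x.
by congr Some; apply: (svalP (cid vert_ord)); exact: (svalP (cid e)).
Qed.

HB.instance Definition _ := PCanIsCountable vert_rankK.
HB.instance Definition _ : isFinite (vert hG) := PCanIsFinite vert_rankK.
HB.instance Definition _ := [finGroupMixin of vert hG for +%R].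

Definition vtau (k : 'I_3) : vert hG := subquot_pi Gamma (tau_lattice k).

Local Close Scope classical_set_scope.

Definition edges : {set {set vert hG}} :=
  [set [set e.1; e.1 + vtau e.2] | e : vert hG * 'I_3].

Definition eps (p q : vert hG) : 'cV[int]_#|edges| :=
  \col_e (enum_val e == [set p; q])%:Z.

(* fvec 0, fvec 1, fvec 2 are f_1, f_2, f_3; the indices k + 1 and k + 2 are
   taken mod 3, so that for instance fvec 2 involves tau 0 and tau 1. *)
Definition fvec (k : 'I_3) (p : vert hG) : 'cV[int]_#|edges| :=
  let a := vtau (k + 1) in
  let b := vtau (k + 2%:R) in
  eps p (p + a) + eps p (p - b) - eps p (p + b) - eps p (p - a).

Definition L : zmodClosed 'cV[int]_#|edges| :=
  int_span (fun kp : 'I_3 * vert hG => fvec kp.1 kp.2).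

Definition B : 'M[int]_(#|edges|, #|{: 'I_3 * vert hG}|) :=
  \matrix_(e, j) fvec (enum_val j).1 (enum_val j).2 e 0.

End Torus.
End Plane.

(* Main.v *)
(* Write T/Gamma = G with translations t_0, t_1, t_2 of sum zero.  Indexing the
   edges {p, p + t_k} by (k, p), which the polyhedrality of the torus allows,
   the span L consists of the triples v_k = c_k - c_k(. + t_k) with
   c_0 + c_1 + c_2 = 0.  Hence v |-> c_0 + c_1 + c_2 embeds Sat L / L in the
   quotient of the functions on G by M, the sums of t_k-invariant functions.  A
   t_k-invariant function depends only on the coordinate of G / <t_k>, which is
   cyclic of order m_k = n / |t_k|.  If h_0 + h_1 + h_2 = 0 modulo a with h_k
   invariant, Pexider's equation shows that each h_k is affine modulo a in its
   coordinate, with a common slope killed by every m_k, i.e. by d.  So the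
   torsion is cyclic of order d, generated by (1/d) times the sum of the three
   coordinates.  With a = 0 the same argument gives the kernel of B, of rank
   n + 2, which is also the free rank of the cokernel as B is square. *)
Require Import Defs.
From HB Require Import structures.
From mathcomp Require Import boolp classical_sets cardinality.
From mathcomp Require Import all_boot all_order all_algebra all_fingroup.
From mathcomp Require Import cyclic generic_quotient ring_quotient reals.
From mathcomp Require Import ring lra zify.

Set Implicit Arguments.
Unset Strict Implicit.
Unset Printing Implicit Defensive.

Import Order.TTheory GRing.Theory Num.Theory.

Local Open Scope ring_scope.
Local Open Scope quotient_scope.

(** * Quotients of abelian groups *)

Lemma pi_quot_eq0 (V : zmodType) (N : zmodClosed V) (x : V) :
  (\pi_{ideal_quot N} x == 0) = (x \in N).
Proof. by rewrite -[x in RHS]subr0 Quotient.idealrBE raddf0. Qed.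

Lemma pi_Zmod_eq0 d (x : int) : (\pi_(Zmod d) x == 0) = (d %| x)%Z.
Proof. exact: pi_quot_eq0. Qed.

Lemma pi_Zmod_eq d (x y : int) :
  \pi_(Zmod d) x = \pi_(Zmod d) y <-> (d %| x - y)%Z.
Proof. by rewrite -pi_Zmod_eq0 raddfB subr_eq0; split=> /eqP. Qed.

(** First isomorphism theorem for an unbundled map, so that [g] may come from a choice function. *)
Lemma quot_iso (V W : zmodType) (N : zmodClosed V) (g : V -> W) :
    {morph g : x y / x - y} -> (forall x, g x = 0 <-> x \in N) ->
    (forall w, exists v, g v = w) ->
  zmod_iso {ideal_quot N} W.
Proof.
move=> gB gN gS; pose f (x : {ideal_quot N}) := g (repr x).
have fpi x : f (\pi x) = g x.
  apply/eqP; rewrite /f -subr_eq0 -gB; apply/eqP/gN.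
  by rewrite Quotient.idealrBE reprK.
have fA : zmod_morphism f.
  by move=> x y; rewrite -[x]reprK -[y]reprK -raddfB !fpi gB.
pose F : {additive {ideal_quot N} -> W} :=
  HB.pack f (GRing.isZmodMorphism.Build _ _ f fA).
exists F; have [h hP] := choice gS.
exists (fun w => \pi_{ideal_quot N} (h w)) => [x|w]; last by rewrite /= fpi hP.
apply/eqP; rewrite -[X in _ == X]reprK -subr_eq0 -raddfB pi_quot_eq0.
by apply/gN; rewrite gB hP /= subrr.
Qed.

(** [g] is additive on [S] alone, because the map it is applied to takes arbitrary values
    elsewhere. *)
Lemma subquot_iso (V W : zmodType) (S N : zmodClosed V) (g : V -> W) :
    {in S &, {morph g : x y / x - y}} ->
    {in S, forall x, g x = 0 <-> x \in N} ->
    (forall w, exists2 v, v \in S & g v = w) ->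
  zmod_iso (subquot S N) W.
Proof.
move=> gB gN gS.
have ex (x : subquot S N) : exists s, s \in S /\ val x = \pi_{ideal_quot N} s.
  by case: x => x /= /asboolP[s sS ->]; exists s.
have [r rP] := choice ex.
pose f x := g (r x).
have fpi x s : s \in S -> val x = \pi_{ideal_quot N} s -> f x = g s.
  move=> sS xs; have [rS xr] := rP x; apply/eqP; rewrite /f -subr_eq0 -gB //.
  by apply/eqP/gN; [exact: rpredB | rewrite -pi_quot_eq0 raddfB /= -xr -xs subrr].
have fA : zmod_morphism f.
  move=> x y; have [xS xE] := rP x; have [yS yE] := rP y.
  by rewrite (fpi _ (r x - r y)) ?rpredB ?gB // [RHS]raddfB /= -xE -yE.
pose F : {additive subquot S N -> W} :=
  HB.pack f (GRing.isZmodMorphism.Build _ _ f fA).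
exists F; have [h hS hE] : exists2 h : W -> V,
    forall w, h w \in S & forall w, g (h w) = w.
  have /choice[h hP] : forall w, exists v, v \in S /\ g v = w.
    by move=> w; have [v vS vE] := gS w; exists v.
  by exists h => w; have [] := hP w.
exists (fun w => subquot_pi N (hS w)) => [x|w]; last by rewrite /= (fpi _ (h w)) ?hE.
have [xS xE] := rP x; apply/val_inj/eqP; rewrite /= [eqbRHS]xE -subr_eq0 -raddfB.
by rewrite pi_quot_eq0; apply/gN; [exact: rpredB | rewrite gB // hE subrr].
Qed.

(** [S / N] is cyclic of order [d], generated by [w]: send [v] to the class of a [b] with [v]
    congruent to [w *~ b]. The map itself is returned because the whole cokernel is later mapped
    through it. *)
Lemma cyclic_quotient_map (V : zmodType) (S N : zmodClosed V) (w : V) (d : nat) :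
    {subset N <= S} -> w \in S -> (forall v, v \in S -> exists b, v - w *~ b \in N) ->
    (forall b, (w *~ b \in N) = (d %| b)%Z) ->
  exists g : V -> Zmod d, [/\ {in S &, {morph g : x y / x - y}},
    {in S, forall x, g x = 0 <-> x \in N} & forall z, exists2 v, v \in S & g v = z].
Proof.
move=> NS wS wgen word.
have /choice[b bP] : forall v, exists b, v \in S -> v - w *~ b \in N.
  move=> v; case: (boolP (v \in S)) => [/wgen[b bN]|_]; first by exists b.
  by exists 0.
have bE v c : v \in S -> v - w *~ c \in N -> \pi_(Zmod d) (b v) = \pi_(Zmod d) c.
  move=> vS vN; apply/pi_Zmod_eq; rewrite -word mulrzBr.
  have -> : w *~ b v - w *~ c = (v - w *~ c) - (v - w *~ b v).
    by rewrite opprB [RHS]addrC addrA subrK.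
  by rewrite rpredB // bP.
exists (fun v => \pi_(Zmod d) (b v)); split=> [x y xS yS|x xS|z].
- rewrite -raddfB; apply: bE; first exact: rpredB.
  have -> : x - y - w *~ (b x - b y) = (x - w *~ b x) - (y - w *~ b y).
    by rewrite mulrzBr !opprB [LHS]addrACA [RHS]addrACA [- y - _]addrC.
  by rewrite rpredB // bP.
- rewrite -(raddf0 \pi_(Zmod d)) pi_Zmod_eq subr0 -word.
  have xN := bP x xS; split=> yN; first by rewrite -[x](subrK (w *~ b x)) rpredD.
  by rewrite -[w *~ _](subKr x) rpredB.
exists (w *~ repr z); first exact: rpredMz.
by rewrite -[RHS]reprK; apply: bE; rewrite ?rpredMz // subrr rpred0.
Qed.

(** * Pexider's equation on the vertex group *)

Lemma additive_intE (U : zmodType) (K : int -> U) :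
  {morph K : x y / x + y} -> forall x, K x = K 1 *~ x.
Proof.
move=> KD; have K0 : K 0 = 0 by apply: (addrI (K 0)); rewrite -KD !addr0.
have KN x : K (- x) = - K x by apply: (addrI (K x)); rewrite -KD !subrr.
have Kn (n : nat) : K n = K 1 *~ n.
  by elim: n => [|n IHn]; rewrite ?K0 // intS KD IHn mulrzDr.
by case=> n; rewrite ?NegzE ?KN Kn // mulrNz.
Qed.

(** Setting one variable to 0 gives [K1 = K0]; y = - x makes [K0] odd, hence [K2 = K0], and the
    equation becomes additivity. *)
Lemma pexider_int (U : zmodType) (K0 K1 K2 : int -> U) :
    (forall x y, K0 x + K1 y + K2 (- x - y) = 0) ->
    K0 0 = 0 -> K1 0 = 0 -> K2 0 = 0 ->
  exists b : U, forall x, [/\ K0 x = b *~ x, K1 x = b *~ x & K2 x = b *~ x].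
Proof.
move=> Ksum K00 K10 K20.
have K01 x : K1 x = K0 x.
  have := Ksum 0 x; have := Ksum x 0.
  rewrite K00 K10 subr0 oppr0 sub0r addr0 add0r.
  by move=> /addr0_eq <- /addr0_eq /oppr_inj.
have K0N x : K0 (- x) = - K0 x.
  apply/esym/addr0_eq; have := Ksum x (- x).
  by rewrite K01 opprK addNr K20 addr0.
have K02 x : K2 x = K0 x.
  have := Ksum 0 (- x).
  by rewrite K00 K01 K0N add0r oppr0 sub0r opprK => /addr0_eq <-; rewrite opprK.
have K0D : {morph K0 : x y / x + y}.
  move=> x y; have /addr0_eq := Ksum x y.
  by rewrite K01 K02 -opprD K0N => /oppr_inj <-.
by exists (K0 1) => x; rewrite K01 K02 (additive_intE K0D).
Qed.

Lemma translation_invariant (G : zmodType) (U : Type) (a : G) (h : G -> U) :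
  (forall p, h (p + a) = h p) -> forall u p, h (p + a *~ u) = h p.
Proof.
move=> ha.
have han (n : nat) p : h (p + a *~ n) = h p.
  by elim: n => [|n IHn]; rewrite ?addr0 // intS mulrzDr mulr1z [a + _]addrC addrA ha.
by case=> n p; rewrite ?NegzE // -(han n.+1 (p + _)) mulrNz addrNK.
Qed.

Lemma I3_ind (P : 'I_3 -> Prop) : P 0 -> P 1 -> P 2%:R -> forall k, P k.
Proof.
move=> P0 P1 P2 [[|[|[|k]]] lt_k3] //.
- by rewrite (_ : Ordinal _ = 0) //; apply: val_inj.
- by rewrite (_ : Ordinal _ = 1) //; apply: val_inj.
by rewrite (_ : Ordinal _ = 2%:R) //; apply: val_inj.
Qed.

Lemma I3E : ((0 + 1 = 1 :> 'I_3) * (1 + 1 = 2%:R :> 'I_3) * (2%:R + 1 = 0 :> 'I_3))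
  * ((0 + 2%:R = 2%:R :> 'I_3) * (1 + 2%:R = 0 :> 'I_3) * (2%:R + 2%:R = 1 :> 'I_3)).
Proof. by do !split; apply: val_inj. Qed.

Lemma sum_I3 (U : nmodType) (F : 'I_3 -> U) : \sum_k F k = F 0 + F 1 + F 2%:R.
Proof.
rewrite !big_ord_recl big_ord0 addr0 addrA.
by congr (F _ + F _ + F _); apply: val_inj.
Qed.

Lemma sum_I3_shift (U : nmodType) (F : 'I_3 -> U) k :
  F k + F (k + 1) + F (k + 2%:R) = F 0 + F 1 + F 2%:R.
Proof.
move: k; apply: I3_ind; rewrite !I3E //; first by rewrite addrC addrA.
by rewrite -addrA addrC.
Qed.

Lemma I3_neq (k l : 'I_3) : k != l -> l = k + 1 \/ k = l + 1.
Proof.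
move=> kl; have [->|lE] := eqVneq l (k + 1); [by left | right; apply/eqP].
by move: k l kl lE; apply: I3_ind; apply: I3_ind.
Qed.

Definition I3_fun (U : Type) (a b c : U) (k : 'I_3) : U :=
  if k == 0 then a else if k == 1 then b else c.

(** * Coordinates on the cyclic quotients and invariant functions *)

Section Translations.
Variables (G : zmodType) (t : 'I_3 -> G) (m : 'I_3 -> nat).
Hypothesis t_sum : t 0 + t 1 + t 2%:R = 0.
Hypothesis t_gen : forall p, exists x y, p = t 1 *~ x - t 0 *~ y.
Hypothesis m_gt0 : forall k, (0 < m k)%N.
(** Thus [m k] is the order of [t (k + 1)] modulo the subgroup generated by [t k]. *)
Hypothesis mP : forall k x,
  (m k %| x)%Z <-> exists u, t (k + 1) *~ x = t k *~ u.

(* In the basis t_0, t_1 of the lattice, the coordinate modulo <t_k> is, for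
   k = 0, 1, 2, the linear form x, y, - x - y of the point x t_1 - y t_0. *)
Definition point (x y : int) : G := t 1 *~ x - t 0 *~ y.

Definition coord_form (x y : int) : 'I_3 -> int := I3_fun x y (- x - y).

Lemma point_coord x y k : exists u,
  point x y = t (k + 1) *~ coord_form x y k + t k *~ u.
Proof.
have t2 : t 2%:R = - t 0 - t 1.
  by apply/esym/eqP; rewrite -opprD eq_sym -addr_eq0 addrC t_sum.
move: k; apply: I3_ind; rewrite /point /coord_form /I3_fun /= !I3E.
(* The witnesses are the coefficients of [t k], found from t_2 = - t_0 - t_1. *)
- by exists (- y); rewrite mulrNz.
- exists (x + y); rewrite t2 mulrzBl mulNrz mulrzDr [t 1 *~ x + t 1 *~ y]addrC.
  by rewrite addrA addrNK addrC.
exists (- x); rewrite t2 mulrNz mulrzBl mulNrz mulrzBr mulrNz opprB opprK.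
by rewrite [RHS]addrC -addrA [t 0 *~ x + (_ - _)]addrA subrr sub0r.
Qed.

Lemma pointP p : exists x y, p = point x y.
Proof. exact: t_gen. Qed.

Lemma coord_exists k p : exists x u, p = t (k + 1) *~ x + t k *~ u.
Proof.
have [x [y ->]] := pointP p; exists (coord_form x y k).
exact: point_coord.
Qed.

(** Reduction modulo [m k] makes the value independent of the representation picked by [cid]; see
    [coordE]. *)
Definition coord (k : 'I_3) (p : G) : int := (sval (cid (coord_exists k p)) %% m k)%Z.

Lemma coordE k p x u : p = t (k + 1) *~ x + t k *~ u -> coord k p = (x %% m k)%Z.
Proof.
rewrite /coord; case: cid => y /= [v ->] /(canRL (addrK _)) yE.
apply/eqP; rewrite eqz_mod_dvd; apply/mP; exists (u - v).
by rewrite !mulrzBr yE addrC -[_ + _ - _]addrA addKr.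
Qed.

Lemma coord_point k x y : coord k (point x y) = (coord_form x y k %% m k)%Z.
Proof. by have [u /coordE] := point_coord x y k. Qed.

Lemma coord_translation k p : coord k (p + t k) = coord k p.
Proof.
have [x [u pE]] := coord_exists k p; rewrite (coordE pE).
by apply: (@coordE _ _ _ (u + 1)); rewrite pE mulrzDr mulr1z addrA.
Qed.

Lemma coord0 k : coord k 0 = 0.
Proof. by rewrite (@coordE k 0 0 0) ?mod0z // !mulr0z addr0. Qed.

Section Invariants.
Variables (U : zmodType) (h : 'I_3 -> G -> U).
Hypothesis h_inv : forall k p, h k (p + t k) = h k p.

(** [p] and the multiple of [t (k + 1)] by its reduced coordinate lie in one coset of the subgroup
    generated by [t k]. *)
Lemma invariant_coord k p : h k p = h k (t (k + 1) *~ coord k p).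
Proof.
have [x [u pE]] := coord_exists k p; rewrite (coordE pE) {1}pE.
rewrite translation_invariant //.
have /mP[v tE] : (m k %| x - (x %% m k)%Z)%Z by rewrite -eqz_mod_dvd modz_mod.
rewrite -[RHS](translation_invariant (h_inv k) v) -tE; congr (h k _).
by rewrite mulrzBr [RHS]addrC addrNK.
Qed.

Hypothesis h_sum : forall p, \sum_k h k p = 0.

(* Along the coordinates the h_k solve Pexider's equation
   H_0(x) + H_1(y) + H_2(- x - y) = 0, so they are affine with common slope. *)
Lemma invariants_affine : exists2 b : U, forall k, b *~ m k = 0
  & forall k p, h k p = h k 0 + b *~ coord k p.
Proof.
pose K k x := h k (t (k + 1) *~ x) - h k 0.
have K0 k : K k 0 = 0 by rewrite /K mulr0z subrr.
have Kpoint x y k : K k (coord_form x y k) = h k (point x y) - h k 0.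
  by have [u ->] := point_coord x y k; rewrite translation_invariant.
have [||||b bP] := @pexider_int U (K 0) (K 1) (K 2%:R); try exact: K0.
  move=> x y; have := Kpoint x y; rewrite /coord_form => Kp.
  rewrite (Kp 0) (Kp 1) (Kp 2%:R).
  rewrite -(sum_I3 (fun k => h k (point x y) - h k 0)) sumrB !h_sum subrr //.
have KE k x : K k x = b *~ x.
  by move: k; apply: I3_ind; have [] := bP x.
(* [m k] copies of [t (k + 1)] make a multiple of [t k], so the linear function [K k] vanishes at
   [m k]. *)
have bm k : b *~ m k = 0.
  have /mP[u tE] := dvdzz (m k).
  by rewrite -(KE k) /K tE -[t k *~ u]add0r translation_invariant // subrr.
exists b => // k p; rewrite -(KE k) /K -invariant_coord addrC subrK //.
Qed.

End Invariants.

(** Over the integers the common slope is killed by [m 0], which is positive, so it is 0. *)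
Lemma invariants_const (h : 'I_3 -> G -> int) :
    (forall k p, h k (p + t k) = h k p) -> (forall p, \sum_k h k p = 0) ->
  forall k p, h k p = h k 0.
Proof.
move=> hinv hsum k p; have [b bm ->] := invariants_affine hinv hsum.
have /eqP := bm 0; rewrite -mulrzr mulf_eq0 intr_eq0 => /orP[/eqP->|].
  by rewrite mul0rz addr0.
by have := m_gt0 0; lia.
Qed.

(** * The torsion of the cokernel *)

(** The edge-coordinate form of [L]: [v k p] stands for the entry at the edge from [p] to [p + t k],
    and [c] is a potential of [v]. *)
Definition translation_span (v : 'I_3 -> G -> int) : Prop :=
  exists2 c : 'I_3 -> G -> int, forall p, \sum_k c k p = 0
  & forall k p, v k p = c k p - c k (p + t k).

Variables (d : nat) (i j : 'I_3).
Hypothesis d_dvd : forall k, (d %| m k)%N.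
Hypothesis d_gcd : gcdn (m i) (m j) = d.

Definition coord_sum (p : G) : int := ((\sum_k coord k p) %/ d)%Z.

(** Differences of the potential ([coord_sum], 0, 0). Times [d], the vector has another potential,
    with [coord k] subtracted from component [k]; that one sums to 0. *)
Definition sat_gen (k : 'I_3) (p : G) : int :=
  if k == 0 then coord_sum p - coord_sum (p + t k) else 0.

(** Modulo [m k], hence modulo [d], coordinate [k] is the corresponding form among x, y, - x - y,
    and these sum to 0; so the division by [d] is exact. *)
Lemma coord_sumE p : \sum_k coord k p = coord_sum p * d.
Proof.
rewrite divzK //; have [x [y ->]] := pointP p.
have form0 : \sum_k coord_form x y k = 0.
  by rewrite sum_I3 /coord_form /I3_fun /=; ring.
rewrite -[X in (_ %| X)%Z]subr0 -[X in _ - X]form0 -sumrB; apply: rpred_sum => k _.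
rewrite coord_point -[_ \in _]/(d %| _)%Z; apply: (@dvdz_trans (m k)).
  by rewrite dvdzE /= d_dvd.
by rewrite -eqz_mod_dvd modz_mod.
Qed.

Lemma sat_gen_order (b : int) :
  translation_span (fun k p => sat_gen k p * b) <-> (d %| b)%Z.
Proof.
split=> [[c c_sum cE] | /dvdzP[e ->]].
  (* The difference of two potentials of the same vector, hence invariant. *)
  pose g k p := c k p - (if k == 0 then coord_sum p * b else 0).
  have g_inv k p : g k (p + t k) = g k p.
    have := cE k p; rewrite /g /sat_gen; by case: eqP => _; lra.
  have g_sum p : \sum_k g k p = - (coord_sum p * b).
    by rewrite sumrB c_sum sum_I3 /= !addr0 sub0r.
  (* The coordinates cancel the sum of [g]: the [h k] are invariant with sum 0, so they are
     constant. *)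
  pose h k p := coord k p * b + g k p * d.
  have h_const : forall k p, h k p = h k 0.
    apply: invariants_const => [k p|p]; first by rewrite /h g_inv coord_translation.
    by rewrite big_split /= -!mulr_suml coord_sumE g_sum; ring.
  have := h_const 0 (t 1); rewrite /h coord0 (@coordE _ _ 1 0); last first.
    by rewrite I3E mulr1z mulr0z addr0.
  move=> hE; have : (d %| (1 %% m 0%R)%Z * b)%Z.
    by apply/dvdzP; exists (g 0 0 - g 0 (t 1)); lra.
  have /dvdzP[e mE] : (d %| (m 0%R)%:Z)%Z by rewrite dvdzE /= d_dvd.
  rewrite /modz mulrBl mul1r mE => dvd_b.
  (* The residue of 1 is 1 minus a multiple of [m 0], thus of [d]. This includes [m 0 = 1], where
     the residue is 0. *)
  have -> : b = b - (1 %/ (e * d))%Z * (e * d) * b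
      + (1 %/ (e * d))%Z * e * b * d by ring.
  by rewrite rpredD // dvdz_mull.
(* The invariant coordinates change no difference and bring the sum of the potential to 0. *)
exists (fun k p => ((if k == 0 then coord_sum p * d else 0) - coord k p) * e).
  by move=> p; rewrite -mulr_suml sumrB coord_sumE sum_I3 /= !addr0 subrr mul0r.
move=> k p; rewrite coord_translation /sat_gen; case: eqP => _; ring.
Qed.

(** [C] is invariant modulo [a], so it is an invariant [h] plus [a] times a potential [c] of [v].
    The affine form of [h] modulo [a] yields an invariant correction of [c] whose sum is a constant
    plus a multiple of [coord_sum]. *)
Lemma sat_gen_generates (v : 'I_3 -> G -> int) (a : int) :
    a != 0 -> translation_span (fun k p => v k p * a) ->
  exists b : int, translation_span (fun k p => v k p - sat_gen k p * b).
Proof.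
move=> a0 [C C_sum CE].
pose rep k p := t (k + 1) *~ coord k p.
have dvd_rep k p : (a %| C k p - C k (rep k p))%Z.
  rewrite -[(a %| _)%Z]/(`|a|%N %| _)%Z; apply/(pi_Zmod_eq `|a|%N).
  apply: (@invariant_coord _ (fun k p => \pi_(Zmod `|a|%N) (C k p))) => {}k {}p.
  apply/(pi_Zmod_eq `|a|%N); rewrite -[(_ %| _)%Z]/(a %| _)%Z -opprB -CE.
  by rewrite rpredN dvdz_mull.
have /choice[c cE] : forall kp : 'I_3 * G, exists x,
    C kp.1 kp.2 = C kp.1 (rep kp.1 kp.2) + x * a.
  by case=> k p; have /dvdzP[x xE] := dvd_rep k p; exists x; rewrite -xE /=; ring.
pose h k p := C k (rep k p).
have h_inv k p : h k (p + t k) = h k p by rewrite /h /rep coord_translation.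
have vE k p : v k p = c (k, p) - c (k, p + t k).
  apply: (mulIf a0); rewrite CE (cE (k, p)) (cE (k, p + t k)) /=.
  by rewrite -!/(h _ _) h_inv; ring.
have h_sum p : \sum_k h k p = - (\sum_k c (k, p)) * a.
  apply/eqP; rewrite mulNr -addr_eq0 mulr_suml -big_split /=.
  by rewrite -[eqbRHS](C_sum p); apply/eqP/eq_bigr => k _; rewrite (cE (k, p)).
have [||b bm hE] := @invariants_affine (Zmod `|a|%N)
  (fun k p => \pi_(Zmod `|a|%N) (h k p)).
- by move=> k p; rewrite h_inv.
- move=> p; rewrite -raddf_sum h_sum; apply/eqP; rewrite pi_Zmod_eq0.
  by rewrite -[(_ %| _)%Z]/(a %| _)%Z dvdz_mull.
pose b0 := repr b; have bE : b = \pi_(Zmod `|a|%N) b0 by rewrite reprK.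
have b_dvd k : (a %| b0 * m k)%Z.
  by rewrite -[(a %| _)%Z]/(`|a|%N %| _)%Z -pi_Zmod_eq0 -mulrzz raddfMz /= -bE bm.
(* [a] divides the products of [b0] with [m i] and [m j], hence with their gcd [d]. *)
have /dvdzP[e b0d] : (a %| b0 * d)%Z.
  rewrite dvdzE abszM /= -d_gcd muln_gcdr dvdn_gcd.
  by have := b_dvd i; have := b_dvd j; rewrite !dvdzE !abszM /= => -> ->.
have /choice[g gE] : forall kp : 'I_3 * G, exists x,
    h kp.1 kp.2 = h kp.1 0 + b0 * coord kp.1 kp.2 + x * a.
  case=> k p /=; have : (a %| h k p - (h k 0%R + b0 * coord k p))%Z.
    by apply/(pi_Zmod_eq `|a|%N); rewrite hE [RHS]raddfD -mulrzz raddfMz /= -bE.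
  by case/dvdzP=> x xE; exists x; rewrite -xE; ring.
have g_inv k p : g (k, p + t k) = g (k, p).
  apply: (mulIf a0); have := gE (k, p + t k); rewrite /= h_inv coord_translation.
  by rewrite (gE (k, p)) => /addrI.
(* The sum of [c + g] is a constant minus [coord_sum * e]. The term at [k = 0] cancels it, and its
   differences are [e] times [sat_gen]. *)
exists (- e); exists (fun k p => c (k, p) + g (k, p) +
    (if k == 0 then coord_sum p * e - \sum_l c (l, 0) else 0)).
  move=> p; rewrite !big_split /= [X in _ + X]sum_I3 /= !addr0.
  apply: (mulIf a0); rewrite mul0r !mulrDl mulNr.
  have := h_sum p; rewrite (eq_bigr _ (fun k _ => gE (k, p))) /= !big_split /=.
  rewrite (h_sum 0) -mulr_sumr coord_sumE -mulr_suml mulrCA b0d => E.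
  lra.
move=> k p; rewrite vE g_inv /sat_gen; case: eqP => _; ring.
Qed.

End Translations.

(** * Smith normal form *)

Lemma mulrz_mxE N q (A : 'M[int]_(N, q)) z i j : (A *~ z) i j = A i j * z.
Proof. by rewrite -scaler_int mxE intz mulrC. Qed.

(* For a square matrix the free rank of the cokernel is the rank of the
   kernel: both count the zero entries of the Smith normal form. *)
Lemma Sat_im_mxP (N N' k : nat) (B : 'M[int]_(N, N'))
    (K : 'M[int]_(N', k)) (T : 'M[int]_(k, N')) :
    N = N' -> T *m K = 1%:M -> B *m K = 0 ->
    (forall x : 'cV_N', B *m x = 0 -> x = K *m (T *m x)) ->
  exists (P : 'M[int]_(k, N)) (Q : 'M[int]_(N, k)), P *m Q = 1%:M
    /\ forall v, (v \in Sat (im_mx B)) = (P *m v == 0).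
Proof.
move=> eqN; case: N' / eqN B K T => B K T TK BK kerB.
have [L Lu [R Ru [d _ defB]]] := int_Smith_normal_form B.
set D := \matrix_(i, j) _ in defB.
pose f (j : 'I_#|[pred i : 'I_N | d`_i == 0]|) := enum_val j.
have f0 j : d`_(f j) = 0 by have := enum_valP j; rewrite inE => /eqP.
(* [F] extracts the entries where the diagonal is 0; the columns of its transpose span the kernel of
   [D]. *)
pose F : 'M[int]_(_, N) := rowsub f 1%:M.
have DE q (x : 'M_(N, q)) i j : (D *m x) i j = d`_i * x i j.
  rewrite mxE (bigD1 i) //= big1 ?addr0 ?mxE ?eqxx ?mulr1n // => l li.
  by rewrite mxE val_eqE eq_sym (negPf li) mul0r.
have FE q (x : 'M_(N, q)) : F *m x = rowsub f x by rewrite mul_rowsub_mx mul1mx.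
have FF : F *m F^T = 1%:M.
  by apply/matrixP => a b; rewrite FE !mxE (inj_eq enum_val_inj) eq_sym.
have DF : D *m F^T = 0.
  apply/matrixP => a b; rewrite DE !mxE; case: eqP => [<-|_]; last by rewrite mulr0.
  by rewrite f0 mul0r.
have FD : F *m D = 0.
  by apply/matrixP => a b; rewrite FE !mxE f0 mul0rn.
have FK q (x : 'M_(N, q)) : D *m x = 0 -> F^T *m (F *m x) = x.
  move=> Dx; apply/matrixP => a b; rewrite FE mxE.
  have [da | da] := eqVneq d`_a 0.
    have aI : a \in [pred i : 'I_N | d`_i == 0] by rewrite inE da.
    rewrite (bigD1 (enum_rank_in aI a)) //= big1 ?addr0 ?mxE /f ?enum_rankK_in //.
      by rewrite eqxx mul1r.
    move=> l li; rewrite !mxE; case: eqP => [fl|]; last by rewrite mul0r.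
    by case/eqP: li; apply: enum_val_inj; rewrite enum_rankK_in.
  have /eqP := DE _ x a b; rewrite Dx mxE eq_sym mulf_eq0 (negPf da) /= => /eqP->.
  rewrite big1 // => l _; rewrite !mxE; case: eqP => [fl|]; last by rewrite mul0r.
  by rewrite -fl f0 eqxx in da.
have kerBm q (X : 'M_(N, q)) : B *m X = 0 -> K *m (T *m X) = X.
  move=> BX; apply/matrixP => a b.
  have /kerB : B *m col b X = 0 by rewrite colE mulmxA BX mul0mx.
  by rewrite colE !mulmxA -!colE => /colP/(_ a); rewrite !mxE.
(* The columns of [K] and of [invmx R *m F^T] are two bases of the kernel of [B]; [M] and [M'] are
   the changes of basis between them. *)
pose M := T *m invmx R *m F^T; pose M' := F *m R *m K.
have MM' : M *m M' = 1%:M.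
  rewrite /M /M' -!mulmxA FK ?mulKmx // mulmxA.
  by rewrite -[LHS](mulKmx Lu) [L *m _]mulmxA [L *m _]mulmxA -defB BK mulmx0.
have M'M : M' *m M = 1%:M.
  rewrite /M /M' -!mulmxA kerBm ?mulKVmx //.
  by rewrite defB -!mulmxA mulKVmx // DF !mulmx0.
clearbody M M'; exists (M *m F *m invmx L), (L *m F^T *m M'); split.
  by rewrite !mulmxA mulmxKV // -(mulmxA M) FF mulmx1.
move=> v; set y := invmx L *m v.
have -> : (M *m F *m invmx L *m v == 0) = (F *m y == 0).
  rewrite -!mulmxA -/y; apply/eqP/eqP => [My0|->]; last by rewrite mulmx0.
  by rewrite -[F *m y]mul1mx -M'M -mulmxA My0 mulmx0.
apply/asboolP/eqP => [[a a0 /asboolP[x vE]] | Fy].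
  apply/matrixP => p q; apply: (mulIf a0); rewrite [in RHS]mxE mul0r.
  have /matrixP/(_ p q) : F *m (invmx L *m (v *~ a)) = 0.
    by rewrite vE defB -!mulmxA mulKmx // mulmxA FD mul0mx.
  by rewrite -scaler_int -!scalemxAr [LHS]mxE intz mulrC => ->; rewrite mxE.
(* Since [y] vanishes where the diagonal does, multiplying it by all nonzero diagonal entries puts
   it in the image of [D]. *)
pose a := \prod_(i < N | d`_i != 0) d`_i.
exists a; first by apply/prodf_neq0.
pose z : 'cV[int]_N := \col_i (y i 0 * \prod_(l < N | (d`_l != 0) && (l != i)) d`_l).
apply/asboolP; exists (invmx R *m z).
rewrite defB -!mulmxA mulKVmx // -[LHS](mulKVmx Lu); congr (_ *m _).
apply/colP => i; rewrite DE [z i 0]mxE -scaler_int -scalemxAr [LHS]mxE intz -/y.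
have [di | di] := eqVneq d`_i 0; last by rewrite /a (bigD1 i) //=; ring.
rewrite di mul0r.
have iI : i \in [pred i : 'I_N | d`_i == 0] by rewrite inE di.
have /colP/(_ (enum_rank_in iI i)) := Fy.
by rewrite FE !mxE /f enum_rankK_in // => ->; rewrite mulr0.
Qed.

(** * The lattice L in edge coordinates *)

Section EdgeCoordinates.
Variables (R : realType) (Gamma : zmodClosed 'rV[R]_2) (n : nat)
  (hG : sublattice_of_index Gamma n).
Notation G := (vert hG).
Notation t := (vtau hG).

Definition edge_set (e : G * 'I_3) : {set G} := [set e.1; e.1 + t e.2].

Hypothesis edge_inj : injective edge_set.

Lemma edge_ex e : exists a : 'I_#|edges hG|, enum_val a = edge_set e.
Proof.
have eE : edge_set e \in edges hG by apply: imset_f.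
by exists (enum_rank_in eE (edge_set e)); rewrite enum_rankK_in.
Qed.

Definition edge k p : 'I_#|edges hG| := sval (cid (edge_ex (p, k))).

Lemma edgeP a : exists k p, a = edge k p.
Proof.
have /imsetP[[p k] _ aE] := enum_valP a; exists k, p; apply: enum_val_inj.
by rewrite aE /edge; case: cid.
Qed.

Lemma edge_coordinates : exists r : 'I_#|edges hG| -> 'I_3 * G,
  forall k p, r (edge k p) = (k, p).
Proof.
have /choice[r rE] : forall a, exists kp, a = edge kp.1 kp.2.
  by move=> a; have [k [p ->]] := edgeP a; exists (k, p).
exists r => k p; case: (r (edge k p)) (rE (edge k p)) => l q /= /(congr1 enum_val).
by rewrite /edge; case: cid => a /= ->; case: cid => b /= -> /edge_inj[-> ->].
Qed.

(** Makes [B] square, so that kernel and cokernel have the same rank. *)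
Lemma card_edges : #|edges hG| = #|{: 'I_3 * G}|.
Proof. by rewrite card_imset // !card_prod mulnC. Qed.

Lemma eps_edge l p k q :
  eps p (p + t l) (edge k q) 0 = ((k == l) && (q == p))%:Z.
Proof.
rewrite mxE /edge; case: cid => a /= ->.
by rewrite -[[set p; _]]/(edge_set (p, l)) (inj_eq edge_inj) xpair_eqE andbC.
Qed.

(** The edge from [p] to [p - t l] is the one of direction [l] at [p - t l]. So [fvec i p] takes
    differences of the indicator of [p], with sign + in direction [i + 1] and - in direction
    [i + 2]. *)
Lemma fvec_edge i p k q : fvec i p (edge k q) 0 =
  ((k == i + 1)%:Z - (k == i + 2%:R)%:Z) * ((q == p)%:Z - (q + t k == p)%:Z).
Proof.
have epsB l : eps p (p - t l) (edge k q) 0 = ((k == l) && (q + t k == p))%:Z.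
  have -> : eps p (p - t l) = eps (p - t l) (p - t l + t l).
    by rewrite subrK /eps; apply/colP => a; rewrite !mxE setUC.
  rewrite (eps_edge l (p - t l)); case: eqP => //= ->.
  by rewrite eq_sym subr_eq eq_sym.
have addE (x y z u : 'cV[int]_#|edges hG|) a :
    (x + y - z - u) a 0 = x a 0 + y a 0 - z a 0 - u a 0 by rewrite !mxE.
rewrite /fvec addE (epsB (i + 1)) (epsB (i + 2%:R)).
rewrite (eps_edge (i + 1)) (eps_edge (i + 2%:R)).
by do 4!case: eqP => _.
Qed.

(** Direction [l] receives sign + from the index [l + 2] and - from [l + 1]; the sum over [l]
    telescopes to 0. *)
Definition span_coef (c : 'I_3 * G -> int) l p : int :=
  c (l + 2%:R, p) - c (l + 1, p).

Lemma sum_pred1 (T : finType) (F : T -> int) x : \sum_y (x == y)%:Z * F y = F x.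
Proof.
rewrite (bigD1 x) //= eqxx mul1r big1 ?addr0 // => y /negPf.
by rewrite eq_sym => ->; rewrite mul0r.
Qed.

Lemma sum_fvec_edge c k q : (\sum_i fvec i.1 i.2 *~ c i) (edge k q) 0 =
  span_coef c k q - span_coef c k (q + t k).
Proof.
pose s i : int := (k == i + 1)%:Z - (k == i + 2%:R)%:Z.
transitivity (\sum_i \sum_p s i * ((q == p)%:Z - (q + t k == p)%:Z) * c (i, p)).
  rewrite summxE pair_bigA; apply: eq_bigr => -[i p] _ /=.
  by rewrite mulrz_mxE fvec_edge.
transitivity (\sum_i s i * (c (i, q) - c (i, q + t k))).
  apply: eq_bigr => i _.
  rewrite -(sum_pred1 (fun p => c (i, p)) q) -(sum_pred1 (fun p => c (i, p)) (q + t k)).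
  by rewrite -sumrB mulr_sumr; apply: eq_bigr => p _; ring.
rewrite sum_I3 /s /span_coef !I3E.
by move: (k); apply: I3_ind; rewrite !I3E /=; ring.
Qed.

Lemma L_spanP v : v \in L hG <-> translation_span t (fun k p => v (edge k p) 0).
Proof.
split=> [/asboolP[c ->] | [c c_sum vE]].
  exists (span_coef c) => [p|k p]; last exact: sum_fvec_edge.
  by rewrite sum_I3 /span_coef !I3E; ring.
apply/asboolP.
(* The coefficients matter only up to a common function of the vertex, so those of index 0 are taken
   to be 0. *)
exists (fun i => I3_fun 0 (c 2%:R i.2) (- c 1 i.2) i.1).
apply/colP => a; have [k [p ->]] := edgeP a; rewrite sum_fvec_edge vE.
have c0 q : c 0 q = - c 1 q - c 2%:R q by have := c_sum q; rewrite sum_I3; lia.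
by move: k; apply: I3_ind; rewrite /span_coef !I3E /I3_fun /= ?c0; ring.
Qed.

Lemma mulmx_B x : B hG *m x = \sum_i fvec i.1 i.2 *~ x (enum_rank i) 0.
Proof.
apply/colP => a; rewrite mxE summxE [RHS](reindex _ (onW_bij _ (@enum_val_bij _))) /=.
by apply: eq_bigr => j _; rewrite enum_valK mulrz_mxE mxE.
Qed.

Lemma im_B_L : im_mx (B hG) =i L hG.
Proof.
move=> v; apply/asboolP/asboolP => [[x ->] | [c ->]].
  by exists (fun i => x (enum_rank i) 0); rewrite mulmx_B.
exists (\col_j c (enum_val j)); rewrite mulmx_B.
by apply: eq_bigr => i _; rewrite mxE enum_rankK.
Qed.

End EdgeCoordinates.

(** * The vertex group and the indices of its cyclic subgroups *)

Section VertexGroup.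
Variables (R : realType) (Gamma : zmodClosed 'rV[R]_2) (n : nat)
  (hG : sublattice_of_index Gamma n).
Notation G := (vert hG).
Notation t := (vtau hG).

Lemma card_vert : #|{: G}| = n.
Proof.
have /card_set_bijP[f [fI f_inj f_surj]] := hG.2.
have fn x : (f x < n)%N by exact: (fI x I).
rewrite -[RHS]card_ord; apply: (@bij_eq_card _ _ (fun x : G => Ordinal (fn x))).
have /choice[g gE] : forall i : 'I_n, exists x, f x = i.
  by move=> i; have [x _ xE] := f_surj i (ltn_ord i); exists x.
have finj x y : f x = f y -> x = y by apply: f_inj; apply: mem_set.
by exists g => [x | i]; [apply: finj; rewrite gE | apply: val_inj; rewrite /= gE].
Qed.

Lemma tau_sum : tau R 0 + tau R 1 + tau R 2%:R = 0.
Proof.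
by apply/rowP => a; rewrite !mxE /=; case: eqP => _; lra.
Qed.

Lemma vtau_sum : t 0 + t 1 + t 2%:R = 0.
Proof.
apply: val_inj; rewrite !raddfD /= -!raddfD tau_sum raddf0 //.
Qed.

Lemma vert_gen p : exists x y, p = t 1 *~ x - t 0 *~ y.
Proof.
case: p => p pP; have /asboolP[s /asboolP[c sE] pE] := pP.
(* Obtained by eliminating [tau 2] through the relation of sum zero. *)
exists (c 1 - c 2%:R), (c 2%:R - c 0); apply: val_inj; rewrite raddfB !raddfMz /= pE.
rewrite -!raddfMz -raddfB /= sE sum_I3; congr (\pi_ _ _).
have -> : tau R 2%:R = - tau R 0 - tau R 1.
  by rewrite -opprD; apply/esym/addr0_eq/tau_sum.
by apply/rowP => a; rewrite -!scaler_int !mxE !rmorphB /=; ring.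
Qed.

Lemma vert_expg (x : G) k : (x ^+ k)%g = x *+ k.
Proof. by elim: k => // k IH; rewrite expgS mulrS IH. Qed.

Lemma order_vert_gt0 k : (0 < n %/ #[t k]%g)%N.
Proof.
by rewrite divn_gt0 ?order_gt0 //; have := max_card (mem <[t k]>%g); rewrite card_vert.
Qed.

Lemma vtau_expg_cycle k u : (t k *~ u \in <[t k]>)%g.
Proof.
case: u => u; first by rewrite -pmulrn -vert_expg mem_cycle.
by rewrite NegzE mulrNz -pmulrn -vert_expg groupV mem_cycle.
Qed.

Lemma cycle_vtauP k p : reflect (exists u, p = t k *~ u) (p \in <[t k]>%g).
Proof.
apply: (iffP idP) => [/cycleP[u ->] | [u ->]]; last exact: vtau_expg_cycle.
by exists u; rewrite vert_expg.
Qed.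

Lemma vert_gen_next k p : exists x u, p = t (k + 1) *~ x + t k *~ u.
Proof.
have [x [y ->]] := vert_gen p; have [u uE] := point_coord vtau_sum x y k.
by exists (coord_form x y k), u.
Qed.

(** The coset of [t (k + 1)] generates the quotient by the subgroup of [t k], so its order is that
    of the quotient, [n] over the order of [t k]. *)
Lemma index_vtauP k x : (((n %/ #[t k]%g)%N : int) %| x)%Z <->
  exists u, t (k + 1) *~ x = t k *~ u.
Proof.
set H := <[t k]>%G; set g := coset H (t (k + 1)).
have nH (A : {set G}) : A \subset 'N(H)%g.
  by apply: (subset_trans _ (cent_sub _)); apply/centsP => y _ z _; exact: addrC.
have cosetD x' y' : coset H (x' + y') = (coset H x' * coset H y')%g.
  by rewrite -[x' + y']/(x' * y')%g morphM // (subsetP (nH [set: G])) ?inE.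
have cosetX z : coset H (t (k + 1) *~ z) 
    = (if z is Posz e then g ^+ e else g ^- `|z|)%g.
  have gX e : coset H (t (k + 1) *+ e) = (g ^+ e)%g.
    by rewrite -vert_expg morphX // (subsetP (nH [set: G])) ?inE.
  case: z => z; first exact: gX.
  rewrite NegzE mulrNz -[- _]/(_^-1)%g morphV ?(subsetP (nH [set: G])) ?inE //.
  exact: (congr1 (fun w => w^-1)%g (gX z.+1)).
have gE : (<[g]> = [set: G] / H)%g.
  apply/eqP; rewrite eqEsubset cycle_subG mem_quotient ?inE //=.
  apply/subsetP => _ /morphimP[p _ _ ->]; have [y [u ->]] := vert_gen_next k p.
  rewrite -[X in X \in _]/(coset H (t (k + 1) *~ y + t k *~ u)) cosetD.
  rewrite cosetX (coset_id (vtau_expg_cycle k u)) mulg1.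
  by case: y => y; rewrite ?groupV mem_cycle.
have og : #[g]%g = (n %/ #[t k]%g)%N.
  by rewrite orderE gE card_quotient // -divgS ?subsetT // cardsT card_vert.
have xE : (((n %/ #[t k]%g)%N : int) %| x)%Z = (t (k + 1) *~ x \in H).
  have -> : (t (k + 1) *~ x \in H) = (coset H (t (k + 1) *~ x) == 1%g).
    apply/idP/eqP => [/coset_id //|]; apply: coset_idr.
    by rewrite (subsetP (nH [set: G])) ?inE.
  rewrite dvdzE /= -og order_dvdn cosetX.
  by case: (x) => y //; rewrite eq_invg1.
rewrite xE; split=> [/cycle_vtauP//|]; by move/cycle_vtauP.
Qed.

(** Write m_l for the third index and m_l t_k = u t_{k+2}. Eliminating t_{k+2} gives u t_{k+1} = -
    (m_l + u) t_k, so the first index divides u and the second divides m_l + u. *)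
Lemma gcd_index_dvd_next k :
  (gcdn (n %/ #[t k]%g) (n %/ #[t (k + 1)%R]%g) %| n %/ #[t (k + 2%:R)%R]%g)%N.
Proof.
have tsum : t k + t (k + 1) + t (k + 2%:R) = 0.
  by rewrite sum_I3_shift vtau_sum.
have t2 : t (k + 2%:R) = - t k - t (k + 1) by rewrite -opprD; apply/esym/addr0_eq.
have k3 : k + 2%:R + 1 = k by move: (k); apply: I3_ind; rewrite !I3E.
have k2 : k + 1 + 1 = k + 2%:R by rewrite -addrA.
set ml := (n %/ #[t (k + 2%:R)%R]%g)%N.
have /index_vtauP[u] := dvdzz (ml : int).
rewrite k3 {1}t2 mulrzBl mulNrz => E.
have {}E : t (k + 1) *~ u = t k *~ (- (ml%:Z + u)).
  by rewrite mulrNz mulrzDr E addrAC addNr sub0r opprK.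
have dvd1 : (((n %/ #[t k]%g)%N : int) %| u)%Z.
  by apply/index_vtauP; exists (- (ml%:Z + u)).
have dvd2 : (((n %/ #[t (k + 1)%R]%g)%N : int) %| ml%:Z + u)%Z.
  apply/index_vtauP; exists (u - (ml%:Z + u)).
  by rewrite k2 t2 mulrzBl mulNrz mulrzBr E mulrNz.
set d := gcdn _ _; rewrite -[(d %| ml)%N]/(d%:Z %| ml%:Z)%Z -[ml%:Z](addrK u).
by rewrite rpredB //; [apply: dvdz_trans dvd2 | apply: dvdz_trans dvd1];
  rewrite dvdzE /= ?dvdn_gcdl ?dvdn_gcdr.
Qed.

Lemma gcd_index_dvd i j k : i != j ->
  (gcdn (n %/ #[t i]%g) (n %/ #[t j]%g) %| n %/ #[t k]%g)%N.
Proof.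
have aux a b : (gcdn (n %/ #[t a]%g) (n %/ #[t (a + 1)%R]%g) %| n %/ #[t b]%g)%N.
  have [->|ba] := eqVneq b a; first exact: dvdn_gcdl.
  have [->|ba1] := eqVneq b (a + 1); first exact: dvdn_gcdr.
  have -> : b = a + 2%:R.
    by apply/eqP; move: a b ba ba1; apply: I3_ind; apply: I3_ind.
  exact: gcd_index_dvd_next.
by move=> /I3_neq[->|->]; last rewrite gcdnC.
Qed.

End VertexGroup.

(** * Kernel and cokernel of [B] *)

Section Cokernel.
Variables (R : realType) (Gamma : zmodClosed 'rV[R]_2) (n : nat)
  (hG : sublattice_of_index Gamma n).
Notation G := (vert hG).
Notation t := (vtau hG).
Hypothesis edge_inj : injective (@edge_set _ _ _ hG).

(** In the kernel each [span_coef] is invariant in its own direction; the three sum to 0, so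
    [invariants_const] applies. *)
Lemma ker_BP (x : 'cV_#|{: 'I_3 * G}|) : B hG *m x = 0 <-> forall l p,
  span_coef (fun i => x (enum_rank i) 0) l p
  = span_coef (fun i => x (enum_rank i) 0) l 0.
Proof.
set C := span_coef _; rewrite mulmx_B.
have CE := sum_fvec_edge edge_inj (fun i => x (enum_rank i) 0).
split=> [x0 | Cc].
  have Cinv l p : C l (p + t l) = C l p.
    by apply/esym/eqP; rewrite -subr_eq0 -CE x0 mxE.
  apply: (@invariants_const _ t (fun k => n %/ #[t k]%g)%N) => //.
  - exact: vtau_sum.
  - exact: vert_gen.
  - exact: order_vert_gt0.
  - exact: index_vtauP.
  by move=> p; rewrite sum_I3 /C /span_coef !I3E; ring.
apply/colP => a; have [k [p ->]] := edgeP a.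
by rewrite CE -!/(C _ _) (Cc _ (p + _)) Cc subrr mxE.
Qed.

Definition vert_ind (i : 'I_n) : G := enum_val (cast_ord (esym (card_vert hG)) i).

Lemma vert_ind_inj : injective vert_ind.
Proof. by move=> i j /enum_val_inj /cast_ord_inj. Qed.

Lemma vert_indP p : exists i, p = vert_ind i.
Proof.
exists (cast_ord (card_vert hG) (enum_rank p)).
by rewrite /vert_ind cast_ordK enum_rankK.
Qed.

Let dir (b : 'I_2) : 'I_3 := if b == 0 then 1 else 2%:R.

(* A vector c of coefficients is in the kernel of B iff the differences
   c_1 - c_0 and c_2 - c_0 are constant. *)
Lemma ker_B_basis : exists (K : 'M[int]_(#|{: 'I_3 * G}|, n + 2))
    (T : 'M[int]_(n + 2, #|{: 'I_3 * G}|)),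
  [/\ T *m K = 1%:M, B hG *m K = 0
    & forall x : 'cV_(_), B hG *m x = 0 -> x = K *m (T *m x)].
Proof.
pose f (k : 'I_3) (p : G) := enum_rank (k, p).
(* [K1] holds the indicators of a vertex common to the three indices, [K2] the constants on index 1
   or 2. [T1] reads the values at index 0, and [T2] the two constant differences. *)
pose K1 : 'M[int]_(#|{: 'I_3 * G}|, n) :=
  \matrix_(j, i) ((enum_val j).2 == vert_ind i)%:Z.
pose K2 : 'M[int]_(#|{: 'I_3 * G}|, 2) :=
  \matrix_(j, b) ((enum_val j).1 == dir b)%:Z.
pose T1 : 'M[int]_(n, #|{: 'I_3 * G}|) := rowsub (fun i => f 0 (vert_ind i)) 1%:M.
pose T2 : 'M[int]_(2, #|{: 'I_3 * G}|) :=
  rowsub (fun b => f (dir b) 0) 1%:M - rowsub (fun=> f 0 0) 1%:M.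
have T1E q (x : 'M_(_, q)) : T1 *m x = rowsub (fun i => f 0 (vert_ind i)) x.
  by rewrite mul_rowsub_mx mul1mx.
have T2E q (x : 'M_(_, q)) : T2 *m x = rowsub (fun b => f (dir b) 0) x
    - rowsub (fun=> f 0 0) x.
  by rewrite mulmxBl !mul_rowsub_mx mul1mx.
exists (row_mx K1 K2), (col_mx T1 T2); split.
- rewrite mul_col_row scalar_mx_block !T1E !T2E; congr block_mx; apply/matrixP => i j;
    rewrite !mxE !enum_rankK /=.
  + by rewrite (inj_eq vert_ind_inj); case: eqP.
  + by rewrite /dir; case: (j == 0).
  + by rewrite subrr.
  by move: i j => [[|[|i]] ?] [[|[|j]] ?].
- have BK q (x : 'M_(_, q)) : (forall j, B hG *m col j x = 0) -> B hG *m x = 0.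
    move=> x0; apply/matrixP => a j; have /colP/(_ a) := x0 j.
    by rewrite colE mulmxA -colE !mxE.
  rewrite mul_mx_row !BK ?row_mx0 // => j; apply/ker_BP => l p.
    by rewrite /span_coef !mxE !enum_rankK /=.
  by rewrite /span_coef !mxE !enum_rankK /= !subrr.
move=> x /ker_BP xC; rewrite mul_col_mx mul_row_col T1E T2E.
apply/colP => j; rewrite -(enum_valK j); case: (enum_val j) => k p.
have [i0 pE] := vert_indP p.
rewrite mxE [X in _ = X + _]mxE (bigD1 i0) //= big1 ?addr0; last first.
  move=> i ii0; rewrite !mxE enum_rankK /= pE (inj_eq vert_ind_inj) eq_sym.
  by rewrite (negPf ii0) mul0r.
rewrite [X in _ = _ + X]mxE !big_ord_recl big_ord0 !mxE !enum_rankK /= pE eqxx.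
have := xC 1 p; have := xC 2%:R p; rewrite /span_coef !I3E -pE /f /dir /=.
by move: (k); apply: I3_ind => /=; lra.
Qed.

Lemma cokernel_saturation (i j : 'I_3) (hij : i != j) :
  let d := gcdn (n %/ #[t i]%g) (n %/ #[t j]%g) in
  zmod_iso (Coker (B hG)) ('rV[int]_(n + 2) * Zmod d)%type /\
  zmod_iso (subquot (Sat (L hG)) (L hG)) (Zmod d).
Proof.
move=> d; pose m k := (n %/ #[t k]%g)%N.
have d_dvd k : (d %| m k)%N by exact: gcd_index_dvd.
have spanE v a : v *~ a \in L hG <->
    translation_span t (fun k p => v (edge k p) 0 * a).
  rewrite L_spanP //; split; congr (translation_span t _);
    by apply/funext => k; apply/funext => p; rewrite mulrz_mxE.
have LSat : {subset L hG <= Sat (L hG)}.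
  by move=> v vL; apply/asboolP; exists 1.
pose sg := sat_gen m (vtau_sum hG) (@vert_gen _ _ _ hG) d.
have [r rE] := edge_coordinates edge_inj.
pose w : 'cV[int]_#|edges hG| := \col_a sg (r a).1 (r a).2.
have wE k p : w (edge k p) 0 = sg k p by rewrite mxE rE.
have w_order b : (w *~ b \in L hG) = (d %| b)%Z.
  have sgP := sat_gen_order (vtau_sum hG) (@vert_gen _ _ _ hG)
    (@order_vert_gt0 _ _ _ hG) (@index_vtauP _ _ _ hG) d_dvd b.
  apply/idP/idP => [/spanE | /sgP wb]; last apply/spanE.
    by move=> wb; apply/sgP; congr (translation_span t _): wb;
      apply/funext => k; apply/funext => p; rewrite wE.
  by congr (translation_span t _): wb; apply/funext => k; apply/funext => p; rewrite wE.
have d_gt0 : (0 < d)%N by rewrite gcdn_gt0 order_vert_gt0.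
have w_gen v : v \in Sat (L hG) -> exists b, v - w *~ b \in L hG.
  move=> /asboolP[a a0 /spanE va].
  have [b vb] := sat_gen_generates (vtau_sum hG) (@vert_gen _ _ _ hG)
    (@index_vtauP _ _ _ hG) d_dvd (erefl d) a0 va.
  exists b; apply/L_spanP => //; congr (translation_span t _): vb.
  apply/funext => k; apply/funext => p.
  by rewrite mxE [(- _ : 'M_(_, _)) _ _]mxE mulrz_mxE wE.
have wSat : w \in Sat (L hG).
  by apply/asboolP; exists d; rewrite ?w_order // -lt0n.
have [g [gB gL g_surj]] := cyclic_quotient_map LSat wSat w_gen w_order.
split; last exact: subquot_iso gB gL g_surj.
have [K [T [TK BK kerB]]] := ker_B_basis.
have [P [Q [PQ PSat]]] := Sat_im_mxP (card_edges edge_inj) TK BK kerB.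
have SatE v : (v \in Sat (L hG)) = (P *m v == 0).
  rewrite -PSat; apply/asboolP/asboolP => -[a a0 va]; exists a => //.
    by rewrite im_B_L.
  by rewrite -im_B_L.
(* The projection onto the saturation along the image of [Q]: [P *m v] gives the free part and
   [g (s v)] the torsion part. *)
pose s (v : 'cV[int]_#|edges hG|) := v - Q *m (P *m v).
have sSat v : s v \in Sat (L hG).
  by rewrite SatE mulmxBr !mulmxA PQ mul1mx subrr.
have sB x y : s (x - y) = s x - s y.
  by rewrite /s !mulmxBr !opprB [LHS]addrACA [RHS]addrACA [- y + _]addrC.
apply: (@quot_iso _ _ _ (fun v => ((P *m v)^T, g (s v)))) => [x y|x|[u z]].
- by rewrite sB gB // mulmxBr linearB.
- split=> [[Px /gL xL] | xB].
    have {}Px : P *m x = 0 by rewrite -[P *m x]trmxK Px trmx0.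
    by rewrite im_B_L -[x]subr0 -(mulmx0 _ Q) -Px xL.
  have xL : x \in L hG by rewrite -im_B_L.
  have /eqP Px : P *m x == 0 by rewrite -SatE LSat.
  by rewrite /s Px mulmx0 subr0 trmx0; congr pair; apply/gL; rewrite ?LSat.
have [v vSat <-] := g_surj z; have /eqP Pv : P *m v == 0 by rewrite -SatE.
exists (Q *m u^T + v); rewrite /s mulmxDr Pv addr0 mulmxA PQ mul1mx trmxK.
by rewrite addrAC subrr add0r.
Qed.

End Cokernel.

(** * Polyhedrality *)

Section Tessellation.
Variables (R : realType) (k : 'I_3).

(** Keeping [k] as a parameter treats the three directions of the tessellation at once. *)
Definition lincomb (u v : R) : 'rV[R]_2 := u *: tau R k + v *: tau R (k + 1).

Lemma lincombD u v u' v' : lincomb u v + lincomb u' v' = lincomb (u + u') (v + v').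
Proof. by rewrite /lincomb !scalerDl addrACA. Qed.

Lemma lincombN u v : - lincomb u v = lincomb (- u) (- v).
Proof. by rewrite /lincomb opprD !scaleNr. Qed.

Lemma lincombB u v u' v' : lincomb u v - lincomb u' v' = lincomb (u - u') (v - v').
Proof. by rewrite lincombN lincombD. Qed.

Lemma lincomb0 : lincomb 0 0 = 0.
Proof. by rewrite /lincomb !scale0r addr0. Qed.

Lemma tauE : [/\ tau R k = lincomb 1 0, tau R (k + 1) = lincomb 0 1
  & tau R (k + 2%:R) = - lincomb 1 1].
Proof.
rewrite /lincomb !scale1r !scale0r addr0 add0r; split=> //.
by apply/esym/addr0_eq; rewrite sum_I3_shift tau_sum.
Qed.
Lemma lincomb3 x y z : x *: tau R k + y *: tau R (k + 1) + z *: tau R (k + 2%:R)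
  = lincomb (x - z) (y - z).
Proof.
have [_ _ ->] := tauE; rewrite {1}/lincomb !scale1r scalerN scalerDr opprD.
by rewrite addrACA -!scalerBl.
Qed.
End Tessellation.

Lemma lincomb_inj (R : realType) k (u v : R) : lincomb k u v = 0 -> u = 0 /\ v = 0.
Proof.
have inj0 (x y : R) : lincomb 0 x y = 0 -> x = 0 /\ y = 0.
  move=> /rowP E; have := E 0; have := E 1; rewrite !mxE /= => E1 E0.
  have s0 : Num.sqrt 3 != 0 :> R by rewrite sqrtr_eq0 -ltNge ltr0n.
  have y0 : y = 0 by apply: (mulIf s0); lra.
  by split=> //; move: E0; rewrite y0; lra.
have E2 (x y z : R) : x *: tau R 0 + y *: tau R 1 + z *: tau R 2%:R
    = lincomb 0 (x - z) (y - z) by rewrite -lincomb3 !I3E.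
move: k; apply: I3_ind; first exact: inj0; rewrite /lincomb !I3E.
  by have := E2 0 u v; rewrite scale0r add0r => -> /inj0; lra.
by have := E2 v 0 u; rewrite scale0r addr0 addrC => -> /inj0; lra.
Qed.

Lemma lincomb_lattice (R : realType) k (u v : R) : lincomb k u v \in lattice R ->
  u \is a Num.int /\ v \is a Num.int.
Proof.
move=> /asboolP[c].
have -> : \sum_i tau R i *~ c i = lincomb k (c k - c (k + 2%:R))%:~R
    (c (k + 1) - c (k + 2%:R))%:~R.
  transitivity (tau R k *~ c k + tau R (k + 1) *~ c (k + 1)
      + tau R (k + 2%:R) *~ c (k + 2%:R)).
    by rewrite sum_I3 -(sum_I3_shift (fun i => tau R i *~ c i) k).
  by rewrite -!scaler_int lincomb3 !rmorphB.
move=> /eqP; rewrite -subr_eq0 lincombB => /eqP/lincomb_inj[/subr0_eq-> /subr0_eq->].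
by rewrite !intr_int.
Qed.

Lemma lincomb_in_lattice (R : realType) k (i j : int) :
  lincomb k i%:~R j%:~R \in lattice R.
Proof. by rewrite /lincomb rpredD // scaler_int rpredMz // tau_lattice. Qed.

Lemma int_small (R : realType) (x : R) : x \is a Num.int -> -1 < x < 1 -> x = 0.
Proof.
move=> /intrP[i ->]; rewrite -[-1]/((-1)%:~R) -[1]/(1%:~R) !ltr_int => i1.
by rewrite (_ : i = 0) //; lia.
Qed.

(** * Edges and triangles of the torus *)

Section Polyhedral.
Variables (R : realType) (Gamma : zmodClosed 'rV[R]_2).
Hypothesis Gamma_lattice : {subset Gamma <= lattice R}.
Notation proj := (\pi_{ideal_quot Gamma}).

Lemma proj_eq x y : proj x = proj y <-> x - y \in Gamma.
Proof. by rewrite -pi_quot_eq0 raddfB subr_eq0; split=> /eqP. Qed.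

Lemma proj_lincomb k x u v u' v' :
  proj (x + lincomb k u v) = proj (x + lincomb k u' v') ->
  [/\ u - u' \is a Num.int, v - v' \is a Num.int
    & lincomb k (u - u') (v - v') \in Gamma].
Proof.
move=> /proj_eq; rewrite opprD addrACA subrr add0r lincombB => uvG.
by have [] := lincomb_lattice (Gamma_lattice uvG).
Qed.

(** The edge vectors up to sign, in oblique coordinates: tau_k, tau_{k+1} and - tau_{k+2}. *)
Definition direction (e1 e2 : R) : Prop :=
  [\/ e1 = 1 /\ e2 = 0, e1 = 0 /\ e2 = 1 | e1 = 1 /\ e2 = 1].

Lemma hull_edge k (p : 'rV[R]_2) e1 e2 (q := p + lincomb k e1 e2) z :
  (hull3 p q q z <-> exists2 s : R, 0 <= s <= 1 & z = p + lincomb k (s * e1) (s * e2)) /\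
  (hull3 q p p z <-> exists2 s : R, 0 <= s <= 1 & z = p + lincomb k (s * e1) (s * e2)).
Proof.
have E u v w : u + v + w = 1 -> u *: p + v *: q + w *: q =
    p + lincomb k ((v + w) * e1) ((v + w) * e2).
  move=> /(canRL (addrK _)) /(canRL (addrK _)) ->.
  by apply/rowP => c; rewrite /q /lincomb !mxE; ring.
split; split.
- move=> [u [v [w [u0 v0 w0 uvw ->]]]]; exists (v + w); last exact: E.
  by apply/andP; split; lra.
- move=> [s /andP[s0 s1] ->]; exists (1 - s), s, 0; rewrite E; last by ring.
  by split; rewrite ?addr0 //; lra.
- move=> [u [v [w [u0 v0 w0 uvw ->]]]]; exists u; first by apply/andP; split; lra.
  have -> : u *: q + v *: p + w *: p = (v + w) *: p + u *: q + 0 *: q.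
    by rewrite scale0r addr0 scalerDl -[LHS]addrA [LHS]addrC.
  by rewrite E ?addr0 //; lra.
move=> [s /andP[s0 s1] ->]; exists s, (1 - s), 0; split; [lra..|].
have -> : s *: q + (1 - s) *: p + 0 *: p = (1 - s) *: p + s *: q + 0 *: q.
  by rewrite !scale0r !addr0 addrC.
by rewrite E ?addr0 //; ring.
Qed.

Lemma is_edgeP k F : is_edge F -> exists x e1 e2,
  [/\ x \in lattice R, direction e1 e2 & forall z, F z <->
    exists2 s : R, 0 <= s <= 1 & z = proj (x + lincomb k (s * e1) (s * e2))].
Proof.
move=> [p [q [pL qL adj ->]]].
have [e1 [e2 [e12 pq]]] : exists e1 e2, direction e1 e2 /\
    (q = p + lincomb k e1 e2 \/ p = q + lincomb k e1 e2).
  have [t0 t1 t2] := tauE R k; case: adj => l.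
  have [m ->] : exists m, l = k + m by exists (l - k); rewrite addrC subrK.
  move: m; apply: I3_ind; rewrite ?addr0.
  - by rewrite t0; exists 1, 0; split=> //; constructor 1.
  - by rewrite t1; exists 0, 1; split=> //; constructor 2.
  rewrite t2 => pq; exists 1, 1; split; first by constructor 3.
  by case: pq => ->; [right | left]; rewrite subrK.
wlog pq' : p q pL qL pq {adj} / q = p + lincomb k e1 e2.
  move=> H; case: (pq) => qE; first exact: H.
  have -> : hull3 p q q = hull3 q p p; last by apply: H => //; left.
  apply/funext => z; apply/propext; rewrite qE.
  by have [A B] := hull_edge k q e1 e2 z; split=> [/B/A|/A/B].
exists p, e1, e2; split=> // z; split=> [[y yE <-] | [s s01 ->]].
  have [A _] := hull_edge k p e1 e2 y.
  by move: yE; rewrite pq' => /(proj1 A)[s s01 ->]; exists s.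
exists (p + lincomb k (s * e1) (s * e2)) => //.
by rewrite pq'; apply/(proj1 (hull_edge k p e1 e2 _)); exists s.
Qed.

(** An edge of the torus is determined by its midpoint: the direction must agree, then the parameter
    must be 1/2. *)
Lemma edge_midpoint k F x e1 e2 : x \in lattice R -> is_edge F -> direction e1 e2 ->
    F (proj (x + lincomb k (e1 / 2) (e2 / 2))) ->
  forall z, F z ->
  exists2 s : R, 0 <= s <= 1 & z = proj (x + lincomb k (s * e1) (s * e2)).
Proof.
move=> xL /(is_edgeP k)[y [f1 [f2 [yL f12 FE]]]] e12 /FE[s s01 xE] z /FE[r r01 ->].
exists r => //; move: xE => /proj_eq.
rewrite opprD addrACA lincombB => xyG.
have /lincomb_lattice[i1 i2] :
    lincomb k (e1 / 2 - s * f1) (e2 / 2 - s * f2) \in lattice R.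
  rewrite -[lincomb _ _ _](addKr (x - y)); apply: rpredD; last exact: Gamma_lattice.
  by rewrite rpredN rpredB.
have e_eq_f : e1 = f1 /\ e2 = f2.
  (* Half the determinant of the two directions is an integer of absolute value at most 1/2. *)
  have : (f1 * e2 - f2 * e1) / 2 = 0.
    apply: int_small; last first.
      by case: e12 => -[-> ->]; case: f12 => -[-> ->]; apply/andP; split; lra.
    rewrite (_ : _ / 2 = f1 * (e2 / 2 - s * f2) - f2 * (e1 / 2 - s * f1)); last by ring.
    have [f1Z f2Z] : f1 \is a Num.int /\ f2 \is a Num.int.
      by case: f12 => -[-> ->]; rewrite ?rpred0 ?rpred1.
    by rewrite rpredB // rpredM.
  by case: e12 => -[-> ->]; case: f12 => -[-> ->] => E; split; lra.
have s2 : s = 1 / 2.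
  case: e_eq_f => e1f e2f; apply/esym/eqP; rewrite -subr_eq0; apply/eqP.
  move: s01 => /andP[s0 s1]; apply: int_small; last by apply/andP; split; lra.
  by move: i1 i2; rewrite e1f e2f; case: f12 => -[-> ->]; rewrite ?mulr1.
case: e_eq_f => e1f e2f; apply/proj_eq; rewrite -e1f -e2f opprD addrACA subrr addr0.
rewrite -opprB rpredN; move: xyG; rewrite s2 -e1f -e2f.
by rewrite !mul1r ![2^-1 * _]mulrC !subrr lincomb0 addr0.
Qed.

(** With [down_triangle], the two triangles on either side of the edge from [x] to
    [x - tau (k + 2)]. *)
Definition up_triangle k (x : 'rV[R]_2) :=
  hull3 x (x + lincomb k 1 0) (x + lincomb k 1 1).
Definition down_triangle k (x : 'rV[R]_2) :=
  hull3 x (x + lincomb k 0 1) (x + lincomb k 1 1).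

Lemma up_triangleP k x z : up_triangle k x z <->
  exists u v : R, 0 <= v <= u /\ u <= 1 /\ z = x + lincomb k u v.
Proof.
split=> [[u [v [w [u0 v0 w0 uvw ->]]]] | [u [v [/andP[v0 vu] [u1 ->]]]]].
  exists (v + w), w; split; first by apply/andP; split; lra.
  split; first lra; move: uvw => /(canRL (addrK _)) /(canRL (addrK _)) ->.
  by apply/rowP => c; rewrite /lincomb !mxE; ring.
exists (1 - u), (u - v), v; split; [lra..|].
by apply/rowP => c; rewrite /lincomb !mxE; ring.
Qed.

Lemma down_triangleP k x z : down_triangle k x z <->
  exists u v : R, 0 <= u <= v /\ v <= 1 /\ z = x + lincomb k u v.
Proof.
split=> [[u [v [w [u0 v0 w0 uvw ->]]]] | [u [v [/andP[v0 vu] [u1 ->]]]]].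
  exists w, (v + w); split; first by apply/andP; split; lra.
  split; first lra; move: uvw => /(canRL (addrK _)) /(canRL (addrK _)) ->.
  by apply/rowP => c; rewrite /lincomb !mxE; ring.
exists (1 - v), (v - u), u; split; [lra..|].
by apply/rowP => c; rewrite /lincomb !mxE; ring.
Qed.

Lemma up_triangle_torus k x :
  x \in lattice R -> is_triangle (proj @` up_triangle k x)%classic.
Proof.
move=> xL; have L1 := lincomb_in_lattice R k; have [t0 t1 t2] := tauE R k.
exists x, (x + lincomb k 1 0), (x + lincomb k 1 1); split=> //.
  by split; rewrite // rpredD // (L1 1 0, L1 1 1).
split; last by exists (k + 2%:R); right; rewrite t2 addrK.
  by exists k; left; rewrite t0.
exists (k + 1); left; rewrite t1 -addrA lincombD; congr (_ + lincomb _ _ _); ring.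
Qed.

Lemma down_triangle_torus k x :
  x \in lattice R -> is_triangle (proj @` down_triangle k x)%classic.
Proof.
move=> xL; have L1 := lincomb_in_lattice R k; have [t0 t1 t2] := tauE R k.
exists x, (x + lincomb k 0 1), (x + lincomb k 1 1); split=> //.
  by split; rewrite // rpredD // (L1 0 1, L1 1 1).
split; last by exists (k + 2%:R); right; rewrite t2 addrK.
  by exists (k + 1); left; rewrite t1.
exists k; left; rewrite t0 -addrA lincombD; congr (_ + lincomb _ _ _); ring.
Qed.

Lemma up_triangle_mem k x u v : 0 <= v <= u -> u <= 1 ->
  (proj @` up_triangle k x)%classic (proj (x + lincomb k u v)).
Proof.
by move=> vu u1; exists (x + lincomb k u v) => //; apply/up_triangleP; exists u, v.
Qed.

Lemma down_triangle_mem k x u v : 0 <= u <= v -> v <= 1 ->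
  (proj @` down_triangle k x)%classic (proj (x + lincomb k u v)).
Proof.
by move=> uv v1; exists (x + lincomb k u v) => //; apply/down_triangleP; exists u, v.
Qed.

Lemma up_triangle_inv k x u v :
  (proj @` up_triangle k x)%classic (proj (x + lincomb k u v)) ->
  exists u' v', 0 <= v' <= u' /\ u' <= 1 /\ [/\ u' - u \is a Num.int,
    v' - v \is a Num.int & lincomb k (u' - u) (v' - v) \in Gamma].
Proof.
move=> [_ /up_triangleP[u' [v' [vu [u1 ->]]]] /proj_lincomb E].
by exists u', v'.
Qed.

Lemma down_triangle_inv k x u v :
  (proj @` down_triangle k x)%classic (proj (x + lincomb k u v)) ->
  exists u' v', 0 <= u' <= v' /\ v' <= 1 /\ [/\ u' - u \is a Num.int,
    v' - v \is a Num.int & lincomb k (u' - u) (v' - v) \in Gamma].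
Proof.
move=> [_ /down_triangleP[u' [v' [vu [u1 ->]]]] /proj_lincomb E].
by exists u', v'.
Qed.

Hypothesis Gamma_polyhedral : polyhedral Gamma.

Lemma up_down_neq k :
  (proj @` up_triangle k 0)%classic <> (proj @` down_triangle k 0)%classic.
Proof.
(* The point used is the barycentre of the upper triangle. *)
move=> E; have : (proj @` down_triangle k 0)%classic
    (proj (0 + lincomb k (2 / 3) (1 / 3))).
  by rewrite -E; apply: up_triangle_mem; lra.
move=> /down_triangle_inv[u [v [/andP[u0 uv] [v1 [/int_small iu /int_small iv _]]]]].
have : v - 1 / 3 = 0 by apply: iv; lra.
have : u - 2 / 3 = 0 by apply: iu; lra.
lra.
Qed.

(** The midpoint of the diagonal lies in both triangles and is no vertex, so the intersection is an
    edge through it, which lies on the diagonal. *)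
Lemma up_down_inter k
  (F := (proj @` up_triangle k 0 `&` proj @` down_triangle k 0)%classic) :
  is_edge F /\ (forall z, F z -> exists2 s : R, 0 <= s <= 1 & z = proj (lincomb k s s)).
Proof.
have Fm : F (proj (0 + lincomb k (1 / 2) (1 / 2))).
  by split; [apply: up_triangle_mem | apply: down_triangle_mem]; lra.
have [F0|[a aL Fa]|Fe] := Gamma_polyhedral (up_triangle_torus k (rpred0 _))
  (down_triangle_torus k (rpred0 _)) (@up_down_neq k).
- by move: Fm; rewrite /F F0.
- move: Fm; rewrite /F Fa => -[_ -> /proj_eq aG].
  have : lincomb k (1 / 2) (1 / 2) \in lattice R.
    rewrite -[lincomb _ _ _](subKr a) rpredB // -[lincomb _ _ _]add0r.
    exact: (Gamma_lattice aG).
  move=> /lincomb_lattice[/int_small h _].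
  by exfalso; have : (1 / 2 : R) = 0 by [apply: h; lra]; lra.
split=> // z /(edge_midpoint (k := k) (rpred0 _) Fe (e1 := 1) (e2 := 1)) [].
- by constructor 3.
- exact: Fm.
by move=> s s01 ->; exists s => //; rewrite add0r mulr1.
Qed.

(** Otherwise (0, 1/2) and (1, 1/2) are identified, which gives a common point of the two triangles
    off the diagonal. *)
Lemma tau_notin k : tau R k \notin Gamma.
Proof.
have [-> _ _] := tauE R k; apply/negP => aG.
have [_ FE] := up_down_inter k.
have [|s _] := FE (proj (0 + lincomb k 0 (1 / 2))).
  split; last by apply: down_triangle_mem; lra.
  have -> : proj (0 + lincomb k 0 (1 / 2)) = proj (0 + lincomb k 1 (1 / 2)).
    apply/proj_eq; rewrite opprD addrACA subrr add0r lincombB subrr.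
    by rewrite -rpredN lincombN sub0r opprK oppr0.
  by apply: up_triangle_mem; lra.
rewrite -[lincomb k s s]add0r => /proj_lincomb[i1 i2 _].
have : (1 / 2 : R) = 0.
  apply: int_small; last by lra.
  by rewrite (_ : 1 / 2 = (1 / 2 - s) - (0 - s)); [exact: rpredB | lra].
by lra.
Qed.

(** Otherwise the vertices (1, 0) and (0, 1) are identified, hence lie on the diagonal, at one of
    its ends; then tau_k or tau_{k+1} is in [Gamma]. *)
Lemma tau_neq_next k : tau R k - tau R (k + 1) \notin Gamma.
Proof.
have [t0 t1 t2] := tauE R k; apply/negP; rewrite t0 t1 lincombB subr0 sub0r => abG.
have [_ FE] := up_down_inter k.
have [|s s01] := FE (proj (0 + lincomb k 1 0)).
  split; first by apply: up_triangle_mem; lra.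
  have -> : proj (0 + lincomb k 1 0) = proj (0 + lincomb k 0 1).
    by apply/proj_eq; rewrite opprD addrACA subrr add0r lincombB subr0 sub0r.
  by apply: down_triangle_mem; lra.
rewrite -[lincomb k s s]add0r => /proj_lincomb[i1 i2 sG].
have [s0|s_neq0] := eqVneq s 0.
  by have := tau_notin k; rewrite t0; move: sG; rewrite s0 !subr0 => ->.
have s1 : 1 - s = 0.
  by apply: int_small => //; move: s01; rewrite le_eqVlt eq_sym (negPf s_neq0) /=; lra.
have := tau_notin (k + 1); rewrite t1 -rpredN lincombN.
by move: sG; rewrite s1 (_ : 0 - s = - 1) ?oppr0 => [->|] //; lra.
Qed.

Lemma lincomb_notin k :
  [/\ lincomb k 1 0 \notin Gamma, lincomb k 0 1 \notin Gamma,
      lincomb k 1 1 \notin Gamma & lincomb k 1 (- 1) \notin Gamma].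
Proof.
have [t0 t1 t2] := tauE R k.
rewrite -t0 -t1 -(rpredN _ (lincomb k 1 1)) -t2 !tau_notin; split=> //.
by move: (tau_neq_next k); rewrite t0 t1 lincombB subr0 sub0r.
Qed.

(** Otherwise the upper triangles at 0 and tau_k share the distinct vertices 0 and tau_k, so they
    meet in an edge joining these. Its direction must be tau_k, but neither candidate for its
    midpoint lies in both triangles. *)
Lemma double_tau_notin k : tau R k + tau R k \notin Gamma.
Proof.
have [t0 _ _] := tauE R k; rewrite t0 lincombD addr0; apply/negP => aaG.
have [/negP a_notin /negP b_notin /negP ab_notin /negP amb_notin] := lincomb_notin k.
pose D1 := (proj @` up_triangle k 0)%classic.
pose D2 := (proj @` up_triangle k (lincomb k 1 0))%classic.
have aL : lincomb k 1 0 \in lattice R by exact: (lincomb_in_lattice R k 1 0).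
have mid2 : ~ D2 (proj (0 + lincomb k (1 / 2) 0)).
  have -> : 0 + lincomb k (1 / 2 : R) 0 = lincomb k 1 0 + lincomb k (- (1 / 2)) 0.
    by rewrite add0r lincombD addr0; congr lincomb; lra.
  move=> /up_triangle_inv[u [v [/andP[v0 vu] [u1 [iu iv]]]]].
  have u2 : u - 1 / 2 = 0.
    apply: int_small; last by lra.
    rewrite (_ : u - 1 / 2 = u - - (1 / 2) - 1); last by lra.
    by apply: rpredB; rewrite ?rpred1.
  have -> : v - 0 = 0 by apply: int_small => //; lra.
  by rewrite (_ : u - - (1 / 2) = 1); last by lra.
have mid1 : ~ D1 (proj (0 + lincomb k (3 / 2) 0)).
  move=> /up_triangle_inv[u [v [/andP[v0 vu] [u1 [iu iv]]]]].
  have u2 : u - 1 / 2 = 0.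
    apply: int_small; last by lra.
    rewrite (_ : u - 1 / 2 = u - (3 / 2) + 1); last by lra.
    by apply: rpredD; rewrite ?rpred1.
  have -> : v - 0 = 0 by apply: int_small => //; lra.
  rewrite (_ : u - (3 / 2) = - 1); last by lra.
  by rewrite -rpredN lincombN opprK oppr0.
have D12 : D1 <> D2.
  by move=> E; apply: mid2; rewrite -E; apply: up_triangle_mem; lra.
have F0 : (D1 `&` D2)%classic (proj (0 + lincomb k 0 0)).
  split; first by apply: up_triangle_mem; lra.
  have -> : proj (0 + lincomb k 0 0) = proj (lincomb k 1 0 + lincomb k 1 0).
    apply/proj_eq; rewrite add0r lincombD lincombB addr0 subrr sub0r.
    by rewrite -rpredN lincombN opprK oppr0.
  by apply: up_triangle_mem; lra.
have F1 : (D1 `&` D2)%classic (proj (0 + lincomb k 1 0)).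
  split; first by apply: up_triangle_mem; lra.
  have -> : 0 + lincomb k (1 : R) 0 = lincomb k 1 0 + lincomb k 0 0.
    by rewrite lincomb0 addr0 add0r.
  by apply: up_triangle_mem; lra.
have [FE|[x xL FE]|] := Gamma_polyhedral (up_triangle_torus k (rpred0 _))
  (up_triangle_torus k aL) D12.
- by move: F0; rewrite FE.
- move: F0 F1; rewrite FE => -[_ -> x0] [_ -> ]; rewrite x0 => /esym/proj_eq.
  by rewrite opprD addrACA subrr add0r lincombB !subr0.
move=> /(is_edgeP k)[x [e1 [e2 [xL e12 FE]]]].
have [s s01 /proj_eq G0] := proj1 (FE _) F0.
have [r r01 /proj_eq G1] := proj1 (FE _) F1.
have zero_one q : lincomb k (q * e1) (q * e2) \in lattice R ->
    0 <= q <= 1 -> q = 0 \/ q = 1.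
  move=> /lincomb_lattice[q1 q2] /andP[q0]; rewrite le_eqVlt => /orP[/eqP->|q_lt1];
    first by right.
  left; apply: int_small; last by lra.
  by move: q1 q2; case: e12 => -[-> ->]; rewrite ?mulr1.
have sZ : s = 0 \/ s = 1.
  apply: zero_one => //; rewrite -[lincomb _ _ _](addKr x) rpredD ?rpredN //.
  by apply: Gamma_lattice; rewrite -rpredN; move: G0; rewrite lincomb0 addr0 sub0r.
have rZ : r = 0 \/ r = 1.
  apply: zero_one => //; rewrite -[lincomb _ _ _](addKr x) rpredD ?rpredN //.
  rewrite -[_ + _](subKr (lincomb k 1 0)) rpredB //; apply: Gamma_lattice.
  by move: G1; rewrite add0r.
(* Compares tau_k, the difference of the two shared vertices, with the edge vector up to sign. *)
have rsG : lincomb k (1 - (r - s) * e1) (- (r - s) * e2) \in Gamma.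
  rewrite (_ : lincomb _ _ _ = (0 + lincomb k 1 0 - (x + lincomb k (r * e1) (r * e2)))
    - (0 + lincomb k 0 0 - (x + lincomb k (s * e1) (s * e2)))); first exact: rpredB.
  by apply/rowP => c; rewrite /lincomb !mxE; ring.
have Fm := proj2 (FE _) (ex_intro2 _ _ (1 / 2) _ erefl).
have {}Fm : (D1 `&` D2)%classic (proj (x + lincomb k (1 / 2 * e1) (1 / 2 * e2))).
  by apply: Fm; lra.
have [rs|r_neq_s] := eqVneq r s.
  by apply: a_notin; move: rsG; rewrite rs subrr oppr0 !mul0r subr0.
have rs_cases : r = 1 /\ s = 0 \/ r = 0 /\ s = 1.
  by case: rZ sZ r_neq_s => -> [] -> //; rewrite ?eqxx //; [right | left].
(* Direction tau_k contradicts [mid1] or [mid2]; the other two put a vector excluded by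
   [lincomb_notin] in [Gamma]. *)
case: e12 => -[e1E e2E]; rewrite {}e1E {}e2E ?mulr0 ?mulr1 in rsG G0 G1 Fm.
- case: rs_cases => -[rE sE].
    have xE : proj (x + lincomb k (1 / 2) 0) = proj (0 + lincomb k (1 / 2) 0).
      apply/proj_eq; rewrite opprD addrACA subrr addr0 subr0 -rpredN.
      by move: G0; rewrite sE opprD addrACA subrr addr0 sub0r.
    by apply: mid2; rewrite -xE; case: Fm.
  have xE : proj (x + lincomb k (1 / 2) 0) = proj (0 + lincomb k (3 / 2) 0).
    apply/proj_eq; rewrite -rpredN.
    have <- : 0 + lincomb k 1 0 - (x + lincomb k r 0)
        = - (x + lincomb k (1 / 2) 0 - (0 + lincomb k (3 / 2) 0)).
      by rewrite rE; apply/rowP => c; rewrite /lincomb !mxE; lra.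
    exact: G1.
  by apply: mid1; rewrite -xE; case: Fm.
- case: rs_cases rsG => -[-> ->]; rewrite ?(subr0, sub0r, opprK) => rsG.
    exact: amb_notin.
  exact: ab_notin.
case: rs_cases rsG => -[-> ->]; rewrite ?(subr0, sub0r, opprK) => rsG.
  by apply: b_notin; rewrite -rpredN lincombN oppr0; rewrite subrr in rsG.
apply: b_notin; rewrite (_ : lincomb _ _ _ = lincomb k (1 + 1) 1 - lincomb k (1 + 1) 0).
  exact: rpredB.
by rewrite lincombB subrr subr0.
Qed.

End Polyhedral.

(** Equal edges have the same base point, and then equal translations, or are reversed, which would
    force [t k + t l = 0]. For [k = l] this is excluded by [double_tau_notin], otherwise by
    [tau_notin] for the third direction. *)
Lemma edge_set_inj (R : realType) (Gamma : zmodClosed 'rV[R]_2) (n : nat)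
  (hG : sublattice_of_index Gamma n) :
  polyhedral Gamma -> injective (@edge_set _ _ _ hG).
Proof.
move=> hpoly; pose t := vtau hG; have subG := hG.1.
have t0 k : t k != 0.
  apply/eqP => /(congr1 val); rewrite raddf0 /= => /eqP; rewrite pi_quot_eq0.
  by apply/negP/tau_notin.
have tnext k : t k != t (k + 1).
  apply/eqP => /(congr1 val) /= /proj_eq; apply/negP; exact: tau_neq_next.
have tadd k : t k + t (k + 1) != 0.
  apply: contraNneq (t0 (k + 2%:R)) => tt.
  by have := sum_I3_shift t k; rewrite tt add0r vtau_sum => ->.
have t_inj k l : t k = t l -> k = l.
  move=> tkl; apply/eqP; apply: contraT => /I3_neq[kl|kl].
    by have := tnext k; rewrite -kl tkl eqxx.
  by have := tnext l; rewrite -kl tkl eqxx.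
have tt0 k l : t k + t l != 0.
  have [->|/I3_neq[->|->]] := eqVneq k l; [|exact: tadd|by rewrite addrC tadd].
  apply/eqP => /(congr1 val); rewrite raddf0 raddfD /= -raddfD => /eqP.
  by rewrite pi_quot_eq0; apply/negP/double_tau_notin.
move=> [p k] [q l] /= /setP E; rewrite /edge_set /= in E.
have := E p; have := E (p + t k).
rewrite !inE !eqxx /= orbT => /esym pkE /esym/orP[]/eqP pE.
  move: pkE; rewrite pE (inj_eq (addrI _)) -[X in _ == X]addr0 (inj_eq (addrI _)).
  by rewrite (negPf (t0 k)) => /eqP/t_inj->.
move: pkE; rewrite pE -addrA -[X in _ == X]addr0 !(inj_eq (addrI _)) (negPf (tt0 l k)).
by rewrite -[X in _ == X]addr0 (inj_eq (addrI _)) (negPf (t0 k)).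
Qed.

Theorem proposition4p4 (R : realType) (Gamma : zmodClosed 'rV[R]_2) (n : nat)
    (hG : sublattice_of_index Gamma n) (hpoly : polyhedral Gamma)
    (i j : 'I_3) (hij : i != j) :
  let d := gcdn (n %/ #[vtau hG i]%g) (n %/ #[vtau hG j]%g) in
  zmod_iso (Coker (B hG)) ('rV[int]_(n + 2) * Zmod d)%type /\
  zmod_iso (subquot (Sat (L hG)) (L hG)) (Zmod d).
Proof. exact (@cokernel_saturation _ _ _ hG (edge_set_inj hpoly) i j hij). Qed.
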